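(* Let $A$ be a unital C$^*$-algebra and let $\tau$ be a faithful tracial state on $A$. Let $p,q$ be positive real numbers with $p^{-1}+q^{-1}=1$. Then for every pair of positive elements $a,b\in A$, $$\tau(|ab|)\;\le\;p^{-1}\tau(a^p)+q^{-1}\tau(b^q).$$ Moreover, for positive $a,b\in A$, equality holds in this inequality if and only if $b^q=a^p$.
   Context: For $z\in A$, $|z|=(z^*z)^{1/2}$. *)

(* Defs.v *)
From HB Require Import structures.
From mathcomp Require Import all_boot all_order all_algebra.
From mathcomp Require Import complex.
From mathcomp Require Import all_classical all_reals all_analysis.

Set Implicit Arguments.
Unset Strict Implicit.
Unset Printing Implicit Defensive.

Import Order.TTheory GRing.Theory Num.Theory.
Import numFieldNormedType.Exports.

Local Open Scope classical_set_scope.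
Local Open Scope complex_scope.
Local Open Scope ring_scope.

(* A unital C*-algebra over the complex numbers R[i]. The norm is a field of the
   structure because the libraries have no normed algebras, and their hierarchy
   does not allow GRing.Algebra to be joined with CompleteNormedModule. *)
HB.mixin Record isCStarAlgebra (R : realType) A of GRing.Algebra R[i] A := {
  star : A -> A ;
  cnorm : A -> R ;
  starD : forall x y : A, star (x + y) = star x + star y ;
  starZ : forall (c : R[i]) (x : A), star (c *: x) = (c^*)%R *: star x ;
  starM : forall x y : A, star (x * y) = star y * star x ;
  starK : forall x : A, star (star x) = x ;
  cnormD : forall x y : A, cnorm (x + y) <= cnorm x + cnorm y ;
  cnormZ : forall (c : R[i]) (x : A), cnorm (c *: x) = complex.Re `|c| * cnorm x ;
  cnorm0_eq0 : forall x : A, cnorm x = 0 -> x = 0 ;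
  cnormM : forall x y : A, cnorm (x * y) <= cnorm x * cnorm y ;
  cnorm_star : forall x : A, cnorm (star x * x) = cnorm x ^+ 2 ;
  cnorm_complete : forall u : nat -> A,
    (forall e : R, 0 < e -> exists N, forall m n,
       (N <= m)%N -> (N <= n)%N -> cnorm (u m - u n) < e) ->
    exists l : A, forall e : R, 0 < e -> exists N, forall n,
       (N <= n)%N -> cnorm (u n - l) < e
}.

#[short(type="cstarAlgType")]
HB.structure Definition CStarAlgebra (R : realType) :=
  {A of isCStarAlgebra R A & GRing.Algebra R[i] A}.

Section CStarAlgebraTheory.
Variables (R : realType) (A : cstarAlgType R).
Implicit Types (a x y : A) (f g : R[i]^o -> R[i]^o).

Definition invertible x : Prop := exists y, x * y = 1 /\ y * x = 1.

Definition spectrum a : set R[i]^o := [set z : R[i] | ~ invertible (z%:A - a)].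

Definition positive a : Prop :=
  star a = a /\ forall z : R[i], spectrum a z -> 0 <= z.

Definition cont_spectrum a f : Prop := {within spectrum a, continuous f}.

(* Phi is a unital *-homomorphism from C(spectrum a) to A that maps the
   inclusion of the spectrum in the complex numbers to a. An element of
   C(spectrum a) is represented by any of its extensions to the complex plane;
   the values of Phi at the other functions are irrelevant. *)
Record is_functional_calculus a (Phi : (R[i]^o -> R[i]^o) -> A) : Prop := {
  fcalc_ext : forall f g, cont_spectrum a f -> cont_spectrum a g ->
    (forall z, spectrum a z -> f z = g z) -> Phi f = Phi g ;
  fcalcD : forall f g, cont_spectrum a f -> cont_spectrum a g ->
    Phi (fun z => f z + g z) = Phi f + Phi g ;
  fcalcZ : forall (c : R[i]) f, cont_spectrum a f ->
    Phi (fun z => c * f z) = c *: Phi f ;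
  fcalcM : forall f g, cont_spectrum a f -> cont_spectrum a g ->
    Phi (fun z => f z * g z) = Phi f * Phi g ;
  fcalc_star : forall f, cont_spectrum a f ->
    Phi (fun z => ((f z)^*)%R) = star (Phi f) ;
  fcalc1 : Phi (fun=> 1) = 1 ;
  fcalc_id : Phi (fun z => z) = a
}.

(* f(a), for a normal and f continuous on the spectrum of a: Phi is then unique
   on C(spectrum a). *)
Definition fcalc a f : A :=
  xget 0 [set x | exists2 Phi, is_functional_calculus a Phi & x = Phi f].

(* a^s, for a positive and s > 0; `^ sends 0 to 0 when s > 0. *)
Definition cpow a (s : R) : A := fcalc a (fun z : R[i] => ((complex.Re z) `^ s)%:C).

Definition cabs x : A := cpow (star x * x) 2^-1.

Definition state (tau : {scalar A}) : Prop :=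
  (forall a, positive a -> 0 <= tau a) /\ tau 1 = 1.

Definition tracial (tau : {scalar A}) : Prop :=
  forall x y, tau (x * y) = tau (y * x).

Definition faithful (tau : {scalar A}) : Prop :=
  forall a, positive a -> tau a = 0 -> a = 0.

End CStarAlgebraTheory.

(* Main.v *)
(* For elements a = F(id) and b = G(id) with calculi F and G on nonnegative spectra and a
   contraction u, the functional f (x) g |-> tau (f(a) u* g(b) u) is positive: if
   sum_k f_k(s) g_k(t) >= 0 for all s, t, then its value at sum_k f_k (x) g_k is
   nonnegative, as one sees by discretizing s with a partition of unity. Scalar
   inequalities thus pass to the trace. From
     s t <= s^p / p + t^q / q - m (s^(p/2) - t^(q/2))^2,   m = min (1/p, 1/q),
   one gets, with u = 1 and D = a^(p/2) - b^(q/2),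
     tau (a b) <= tau (a^p) / p + tau (b^q) / q - m tau (D^2),
   and, for every contraction u, the same bound without the last term for
   tau (a u* b u). By Cauchy-Schwarz 2 Re tau (u a b) <= tau (a u* b u) + tau (a b),
   and tau |ab| is the limit of tau (u a b) for u = (|ab| + e)^-1 (ab)*, so equality in
   Young's inequality forces D = 0. Conversely, if a^p = b^q, then b = a^(p/q) and
   |ab| = a^p.

   The functional calculus comes from the bound |h| <= r for selfadjoint h with spectrum
   in [-r, r], proved from square roots instead of complex analysis, and from the
   Weierstrass theorem. *)

Require Import Defs.
From mathcomp Require Import all_boot all_order all_algebra.
From mathcomp Require Import complex.
From mathcomp Require Import ring lra.
From Stdlib Require Ncring Ncring_tac.
From mathcomp Require Import all_classical all_reals all_analysis.

Import Order.TTheory GRing.Theory Num.Theory.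
Import numFieldNormedType.Exports.

Local Open Scope classical_set_scope.
Local Open Scope complex_scope.
Local Open Scope ring_scope.

Set Implicit Arguments.
Unset Strict Implicit.
Unset Printing Implicit Defensive.

(** The partial isometry in the polar decomposition of [a * b] need not lie in [A], so equality has
    to be read off in a limit over [u]. The remainder is therefore taken from the bound at [u = 1]:
    it does not depend on [u] and survives the limit. It is a squared difference of half powers
    because this expands into finitely many products f(s) g(t), the only expressions the positive
    functional can evaluate, and because its value at [u = 1] is exactly tau (D^2).

    [fcalc] picks some calculus by choice, so nothing is known about a power before uniqueness.
    Faithfulness supplies it: a selfadjoint element whose square has trace at most 0 vanishes, and
    if f(a) = g(b), the positive functional bounds the trace of (k(f(a)) - k(g(b)))^2 by every
    positive number. This one argument also gives the composition rules behind b = (b^q)^(1/q) and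
    |ab| = a^p. Faithfulness yields as well the positivity of [star x * x], on which [cabs]
    rests. *)

Section NonCommutativeRing.
Variable A : pzRingType.

Definition nc_ops :
  @Ncring.Ring_ops A 0 1 +%R *%R (fun x y => x - y) -%R (@eq A).
Proof. by split. Defined.

Lemma nc_ring : Ncring.Ring (T := A) (ring_eq := eq) (Ro := nc_ops).
Proof.
split.
- exact: RelationClasses.eq_equivalence.
- by move=> ? ? -> ? ? ->.
- by move=> ? ? -> ? ? ->.
- by move=> ? ? -> ? ? ->.
- by move=> ? ? ->.
- exact: add0r.
- exact: addrC.
- exact: addrA.
- exact: mul1r.
- exact: mulr1.
- exact: mulrA.
- exact: mulrDl.
- by move=> ? ? ?; exact: mulrDr.
- by [].
- exact: subrr.
Qed.

End NonCommutativeRing.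

#[local] Existing Instance nc_ops.
#[local] Existing Instance nc_ring.

Ltac ncring := rewrite ?expr2; Ncring_tac.non_commutative_ring.

Section RealComplex.
Variable R : realType.
Implicit Types x y : R.

Lemma real_complexD x y : (x + y)%:C = x%:C + y%:C :> R[i].
Proof. exact: rmorphD. Qed.

Lemma real_complexB x y : (x - y)%:C = x%:C - y%:C :> R[i].
Proof. exact: rmorphB. Qed.

Lemma real_complexN x : (- x)%:C = - x%:C :> R[i].
Proof. exact: rmorphN. Qed.

Lemma real_complexM x y : (x * y)%:C = x%:C * y%:C :> R[i].
Proof. exact: rmorphM. Qed.

Lemma real_complexV x : x^-1%:C = x%:C^-1 :> R[i].
Proof. exact: fmorphV. Qed.

Lemma real_complex_sum n (F : 'I_n -> R) :
  (\sum_(i < n) F i)%:C = \sum_(i < n) (F i)%:C :> R[i].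
Proof. exact: rmorph_sum. Qed.

End RealComplex.

(** * Norm and involution *)

Section Norm.
Context {R : realType} {A : cstarAlgType R}.
Implicit Types (x y : A) (c : R[i]) (r : R).

Lemma normC_Re (z : R[i]) : (complex.Re `|z|)%:C = `|z|.
Proof. by rewrite RRe_real ?normr_real. Qed.

Lemma cnormZr r x : cnorm (r%:C *: x) = `|r| * cnorm x.
Proof.
rewrite cnormZ; congr (_ * _).
by apply: complexI; rewrite normC_Re normc_def /= expr0n /= addr0 sqrtr_sqr.
Qed.

Lemma cnorm0 : cnorm (0 : A) = 0.
Proof. by rewrite -(scale0r (0 : A)) -[0]/(0%:C) cnormZr normr0 mul0r. Qed.

Lemma cnormN x : cnorm (- x) = cnorm x.
Proof.
rewrite -scaleN1r cnormZ normrN1.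
by rewrite -[1]/(1%:C) /= mul1r.
Qed.

Lemma cnorm_ge0 x : 0 <= cnorm x.
Proof.
have := cnormD x (- x); rewrite subrr cnorm0 cnormN; lra.
Qed.

Lemma cdistC x y : cnorm (x - y) = cnorm (y - x).
Proof. by rewrite -cnormN opprB. Qed.

Lemma cnorm_dist x y : cnorm x <= cnorm y + cnorm (x - y).
Proof. by rewrite -{1}(subrK y x) addrC cnormD. Qed.

Lemma star0 : star (0 : A) = 0.
Proof. by rewrite -(scale0r (0 : A)) starZ conjC0 !scale0r. Qed.

Lemma starN x : star (- x) = - star x.
Proof. by apply/eqP; rewrite -addr_eq0 -starD addNr star0. Qed.

Lemma starB x y : star (x - y) = star x - star y.
Proof. by rewrite starD starN. Qed.

Lemma star1 : star (1 : A) = 1.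
Proof. by rewrite -[LHS]mul1r -{1}(starK 1) -starM mul1r starK. Qed.

Lemma starZr r x : star (r%:C *: x) = r%:C *: star x.
Proof. by rewrite starZ conj_Creal ?complex_real. Qed.

Lemma starX x n : star (x ^+ n) = star x ^+ n.
Proof. by elim: n => [|n IH]; rewrite ?expr0 ?star1 // exprS starM IH -exprSr. Qed.

Lemma cnorm_starE x : cnorm (star x) = cnorm x.
Proof.
suff le y : cnorm y <= cnorm (star y).
  by apply/eqP; rewrite eq_le le -{2}(starK x) le.
have [->|y0] := eqVneq (cnorm y) 0; first exact: cnorm_ge0.
have /ler_pM2r <- : 0 < cnorm y by rewrite lt_def y0 cnorm_ge0.
by rewrite -expr2 -cnorm_star cnormM.
Qed.

Lemma cnorm_sqr_sa x : star x = x -> cnorm (x ^+ 2) = cnorm x ^+ 2.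
Proof. by move=> sx; rewrite -cnorm_star sx expr2. Qed.

Lemma cnorm1 : cnorm (1 : A) = 1.
Proof.
have := cnorm_sqr_sa star1; rewrite expr1n => e.
have /eqP : cnorm (1 : A) * (cnorm (1 : A) - 1) = 0 by rewrite mulrBr mulr1 -expr2 -e subrr.
rewrite mulf_eq0 subr_eq0 => /orP[|/eqP//] /eqP /cnorm0_eq0 /eqP.
by rewrite oner_eq0.
Qed.

Lemma cnorm_le0 x : cnorm x <= 0 -> x = 0.
Proof. by move=> x0; apply: cnorm0_eq0; apply/eqP; rewrite eq_le x0 cnorm_ge0. Qed.

Lemma cnorm_lim_unique x y :
  (forall e : R, 0 < e -> exists z, cnorm (z - x) < e /\ cnorm (z - y) < e) -> x = y.
Proof.
move=> H; apply/eqP; rewrite -subr_eq0; apply/eqP/cnorm_le0.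
rewrite leNgt; apply/negP => d0.
have [|z [zx zy]] := H (cnorm (x - y) / 2); first by rewrite divr_gt0.
by have := cnormD (x - z) (z - y); rewrite addrA subrK (cdistC x z); lra.
Qed.

(** Telescoping gives |u n - u m| <= r n - r m for m <= n, so [u] is Cauchy because the bounded
    monotone [r] is. It serves both the Neumann series and the square root iteration. *)
Lemma dominated_increments (u : nat -> A) (r : nat -> R) (M : R) :
  (forall n, cnorm (u n.+1 - u n) <= r n.+1 - r n) -> (forall n, r n <= M) ->
  exists l, (forall n, cnorm (l - u n) <= M - r n) /\
    forall e : R, 0 < e -> exists N, forall n, (N <= n)%N -> cnorm (u n - l) < e.
Proof.
move=> ur rM.
have inc m k : cnorm (u (k + m)%N - u m) <= r (k + m)%N - r m.
  elim: k => [|k IH]; first by rewrite !add0n !subrr cnorm0.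
  have := cnormD (u (k + m).+1%N - u (k + m)%N) (u (k + m)%N - u m).
  by rewrite addrA subrK addSn; have := ur (k + m)%N; lra.
have incle m n : (m <= n)%N -> cnorm (u n - u m) <= r n - r m.
  by move=> /subnK <-; exact: inc.
have rmono m n : (m <= n)%N -> r m <= r n.
  by move=> /incle; have := cnorm_ge0 (u n - u m); lra.
have [|l lP] := @cnorm_complete R A u.
  move=> e e0.
  pose S := [set r n | n in [set: nat]]%classic.
  have supS : has_sup S.
    by split; [exists (r 0%N), 0%N | exists M => _ [n _ <-]].
  have [_ [N _ <-] sN] := sup_adherent e0 supS.
  have ub n : r n <= sup S by apply: sup_ubound => //; [case: supS|exists n].
  exists N => m n Nm Nn.
  wlog mn : m n Nm Nn / (m <= n)%N.
    move=> W; have [mn|nm] := leqP m n; first exact: W.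
    by rewrite cdistC; apply: W => //; exact: ltnW.
  rewrite cdistC; apply: le_lt_trans (incle _ _ mn) _.
  by have := rmono _ _ Nm; have := ub n; have := rmono _ _ Nn; lra.
exists l; split=> // n.
apply/ler_addgt0Pr => e e0; have [N NP] := lP _ e0.
pose k := maxn N n.
have := NP k (leq_maxl _ _); have := incle n k (leq_maxr _ _).
have := cnormD (l - u k) (u k - u n); rewrite addrA subrK (cdistC l).
by have := rM k; lra.
Qed.

End Norm.

(** * Inverses and square roots *)

Section Inverse.
Context {R : realType} {A : cstarAlgType R}.
Implicit Types (x y z : A) (c : R[i]) (u v : nat -> A).

Definition tends u x :=
  forall e : R, 0 < e -> exists N, forall n, (N <= n)%N -> cnorm (u n - x) < e.

Lemma tends_unique u x y : tends u x -> tends u y -> x = y.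
Proof.
move=> ux uy; apply: cnorm_lim_unique => e e0.
have [N NP] := ux _ e0; have [M MP] := uy _ e0.
by exists (u (maxn N M)); rewrite NP ?leq_maxl // MP ?leq_maxr.
Qed.

Lemma tends_cst x : tends (fun=> x) x.
Proof. by move=> e e0; exists 0%N => n _; rewrite subrr cnorm0. Qed.

Lemma tends_ext u v x : u =1 v -> tends u x -> tends v x.
Proof. by move=> uv H e /H[N NP]; exists N => n; rewrite -uv; exact: NP. Qed.

Lemma tends_shift u x : tends u x -> tends (fun n => u n.+1) x.
Proof. by move=> H e /H[N NP]; exists N => n Nn; apply/NP/leqW. Qed.

Lemma tendsD u v x y : tends u x -> tends v y -> tends (fun n => u n + v n) (x + y).
Proof.
move=> ux vy e e0; have e2 : 0 < e / 2 by rewrite divr_gt0.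
have [N NP] := ux _ e2; have [M MP] := vy _ e2.
exists (maxn N M) => n; rewrite geq_max => /andP[/NP Hu /MP Hv].
by rewrite opprD addrACA; have := cnormD (u n - x) (v n - y); lra.
Qed.

Lemma tendsZ c u x : tends u x -> tends (fun n => c *: u n) (c *: x).
Proof.
move=> ux e e0; set k := complex.Re `|c|.
have k0 : 0 <= k by rewrite /k normc_def /= sqrtr_ge0.
have k1 : 0 < k + 1 by lra.
have [|N NP] := ux (e / (k + 1)); first by rewrite divr_gt0.
exists N => n /NP; rewrite -scalerBr cnormZ -/k ltr_pdivlMr // => H.
by apply: le_lt_trans H; rewrite mulrC ler_wpM2l ?cnorm_ge0//; lra.
Qed.

Lemma tendsM u v x y : tends u x -> tends v y -> tends (fun n => u n * v n) (x * y).
Proof.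
move=> ux vy e e0; pose K := cnorm x + cnorm y + 1.
have xge := cnorm_ge0 x; have yge := cnorm_ge0 y.
have K0 : 0 < K by rewrite /K; lra.
pose d := Num.min 1 (e / K).
have d0 : 0 < d by rewrite lt_min ltr01 divr_gt0.
have d1 : d <= 1 by rewrite ge_min lexx.
have dK : d * K <= e by rewrite -ler_pdivlMr // ge_min lexx orbT.
have [N NP] := ux _ d0; have [M MP] := vy _ d0.
exists (maxn N M) => n; rewrite geq_max => /andP[/NP Hu /MP Hv].
have -> : u n * v n - x * y = (u n - x) * (v n - y) + ((u n - x) * y + x * (v n - y)).
  by ncring.
set s := cnorm (u n - x) in Hu *; set t := cnorm (v n - y) in Hv *.
have h1 := cnormM (u n - x) (v n - y); have h2 := cnormM (u n - x) y.
have h3 := cnormM x (v n - y).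
have h4 := cnormD ((u n - x) * (v n - y)) ((u n - x) * y + x * (v n - y)).
have h5 := cnormD ((u n - x) * y) (x * (v n - y)).
have s0 : 0 <= s := cnorm_ge0 _; have t0 : 0 <= t := cnorm_ge0 _.
rewrite -/s -/t in h1 h2 h3; apply: lt_le_trans dK.
have : s * t <= s by rewrite -[leRHS]mulr1 ler_wpM2l //; lra.
have : s * cnorm y <= d * cnorm y by rewrite ler_wpM2r //; exact: ltW.
have : cnorm x * t <= cnorm x * d by rewrite ler_wpM2l //; exact: ltW.
by rewrite /K; nra.
Qed.

Lemma tends_star u x : tends u x -> tends (fun n => star (u n)) (star x).
Proof. by move=> H e /H[N NP]; exists N => n; rewrite -starB cnorm_starE; exact: NP. Qed.

Lemma invertibleM x y : invertible x -> invertible y -> invertible (x * y).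
Proof.
move=> [x' [xx x'x]] [y' [yy y'y]]; exists (y' * x').
by rewrite -!mulrA (mulrA y) yy mul1r xx; rewrite (mulrA x') x'x mul1r y'y.
Qed.

Lemma invertibleZ c x : c != 0 -> invertible x -> invertible (c *: x).
Proof.
move=> c0 [y [xy yx]]; exists (c^-1 *: y).
by rewrite -!scalerAl -!scalerAr xy yx !scalerA mulfV // mulVf // scale1r.
Qed.

Lemma invertibleN x : invertible x -> invertible (- x).
Proof. by rewrite -scaleN1r => ?; apply: invertibleZ; rewrite // oppr_eq0 oner_eq0. Qed.

Lemma cnormX x n : cnorm (x ^+ n) <= cnorm x ^+ n.
Proof.
elim: n => [|n IH]; first by rewrite !expr0 cnorm1.
by rewrite !exprS (le_trans (cnormM _ _)) // ler_wpM2l // cnorm_ge0.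
Qed.

(** Neumann series: the partial sums are dominated by those of the geometric series of |x|, and the
    limit satisfies l = 1 + x l = 1 + l x. *)
Lemma invertible_1B x : cnorm x < 1 -> invertible (1 - x).
Proof.
move=> x1; set r := cnorm x in x1.
pose u n : A := \sum_(i < n) x ^+ i; pose s n : R := \sum_(i < n) r ^+ i.
have r0 : 0 <= r := cnorm_ge0 _.
have [||l [_ ul]] := @dominated_increments R A u s (1 - r)^-1.
- by move=> n; rewrite /u /s !big_ord_recr /= [X in cnorm (X - _)]addrC [X in _ <= X - _]addrC;
     rewrite !addrK cnormX.
- move=> n; rewrite -[leRHS]mul1r ler_pdivlMr ?subr_gt0 // mulrC.
  by rewrite -opprB mulNr -subrX1 opprB gerBl exprn_ge0.
exists l.
have L : l = 1 + x * l.
  apply: (tends_unique (tends_shift ul)).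
  apply: tends_ext (tendsD (tends_cst 1) (tendsM (tends_cst x) ul)) => n.
  rewrite /u big_ord_recl expr0 mulr_sumr; congr (_ + _).
  by apply: eq_bigr => i _; rewrite exprS.
have L' : l = 1 + l * x.
  apply: (tends_unique (tends_shift ul)).
  apply: tends_ext (tendsD (tends_cst 1) (tendsM ul (tends_cst x))) => n.
  rewrite /u big_ord_recl expr0 mulr_suml; congr (_ + _).
  by apply: eq_bigr => i _; rewrite exprSr.
by split; [rewrite mulrBl mul1r {1}L | rewrite mulrBr mulr1 {1}L']; rewrite addrK.
Qed.

(* [1 - sqrt (1 - x)] is the limit of [y' = (x + y^2) / 2], dominated by the scalar
   iteration at [x = 1]. *)
Lemma sqrt_1B x : star x = x -> cnorm x <= 1 ->
  exists w, [/\ star w = w, w ^+ 2 = 1 - x & forall z, z * x = x * z -> z * w = w * z].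
Proof.
move=> sx x1.
pose y := fix y n : A := if n is m.+1 then 2^-1%:C *: (x + y m * y m) else 0.
pose r := fix r n : R := if n is m.+1 then 2^-1 * (1 + r m * r m) else 0.
have yS n : y n.+1 = 2^-1%:C *: (x + y n * y n) by [].
have rS n : r n.+1 = 2^-1 * (1 + r n * r n) by [].
have half (z : A) : cnorm (2^-1%:C *: z) = 2^-1 * cnorm z.
  by rewrite cnormZr ger0_norm // invr_ge0.
have r01 n : 0 <= r n <= 1 by elim: n => [|n /andP[]] /=; [lra | nra].
have yr n : cnorm (y n) <= r n.
  elim: n => [|n IH] /=; first by rewrite cnorm0.
  rewrite half ler_pM2l ?invr_gt0 //.
  have := cnormD x (y n * y n); have := cnormM (y n) (y n).
  have := cnorm_ge0 (y n); nra.
have inc n : cnorm (y n.+1 - y n) <= r n.+1 - r n.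
  elim: n => [|n IH]; first by rewrite !subr0 yr.
  (* Y^2 - Z^2 = Y (Y - Z) + (Y - Z) Z holds without commutation, and the scalar iteration has the
     same shape, so the norms compare term by term. *)
  have -> : y n.+2 - y n.+1 =
      2^-1%:C *: (y n.+1 * (y n.+1 - y n) + (y n.+1 - y n) * y n).
    by rewrite (yS n.+1) [X in _ - X](yS n) -scalerBr; congr (_ *: _); ncring.
  have -> : r n.+2 - r n.+1 = 2^-1 * (r n.+1 * (r n.+1 - r n) + (r n.+1 - r n) * r n).
    by rewrite (rS n.+1) [X in _ - X](rS n); ring.
  rewrite half ler_pM2l ?invr_gt0 //.
  have := r01 n; have := r01 n.+1; move=> /andP[? ?] /andP[? ?].
  have h1 := cnormM (y n.+1) (y n.+1 - y n); have h2 := cnormM (y n.+1 - y n) (y n).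
  have h3 := cnormD (y n.+1 * (y n.+1 - y n)) ((y n.+1 - y n) * y n).
  have h4 := yr n; have h5 := yr n.+1.
  have h6 := cnorm_ge0 (y n.+1 - y n).
  move: (y n.+1) (y n) (r n.+1) (r n) IH h1 h2 h3 h4 h5 h6 (cnorm_ge0 (y n)) (cnorm_ge0 (y n.+1)).
  by move=> Y Y' s s' *; nra.
have [|l [_ yl]] := @dominated_increments R A y r 1 inc; first by move=> n; case/andP: (r01 n).
(* The limit is a fixed point, 2 l = x + l^2, which says that (1 - l)^2 = 1 - x. *)
have L : l + l = x + l * l.
  have := tends_unique (tends_shift yl) (tendsZ 2^-1%:C (tendsD (tends_cst x) (tendsM yl yl))).
  by move=> {1 2}->; rewrite -scalerDl -rmorphD /= [_ + _](_ : _ = 1) ?scale1r //; lra.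
exists (1 - l); split.
- rewrite starB star1; congr (_ - _); apply: tends_unique (tends_star yl) _.
  apply: tends_ext yl; elim=> [|n IH]; first by rewrite star0.
  by rewrite /= starZr starD starM sx -IH.
- have -> : x = l + l - l * l by rewrite L addrK.
  by ncring.
- move=> z zx; rewrite mulrBr mulrBl mulr1 mul1r; congr (_ - _).
  apply: tends_unique (tendsM (tends_cst z) yl) _.
  apply: tends_ext (tendsM yl (tends_cst z)); elim=> [|n IH]; first by rewrite mul0r mulr0.
  by rewrite /= -scalerAl -scalerAr mulrDl mulrDr zx -mulrA IH mulrA IH mulrA.
Qed.

End Inverse.

(** * Spectra of selfadjoint elements *)

Section Spectrum.
Context {R : realType} {A : cstarAlgType R}.
Implicit Types (x y h : A) (z c : R[i]) (r t : R).

Lemma halfD x : 2^-1%:C *: (x + x) = x.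
Proof.
rewrite scalerDr -scalerDl -rmorphD /= [_ + _](_ : _ = 1) ?scale1r //; lra.
Qed.

Lemma sqr_Re_norm z : complex.Re `|z| ^+ 2 = complex.Re z ^+ 2 + complex.Im z ^+ 2.
Proof. by rewrite normc_def /= sqr_sqrtr // addr_ge0 ?sqr_ge0. Qed.

Lemma Re_norm_ge0 z : 0 <= complex.Re `|z|.
Proof. by rewrite normc_def /= sqrtr_ge0. Qed.

Lemma spectrum_bound x z : spectrum x z -> complex.Re `|z| <= cnorm x.
Proof.
move=> xz; rewrite leNgt; apply/negP => lt; apply: xz.
have z0 : z != 0.
  apply/eqP => z0; move: lt; rewrite z0 normr0 /=.
  by have := cnorm_ge0 x; lra.
have -> : z%:A - x = z *: (1 - z^-1 *: x).
  by rewrite scalerBr scalerA mulfV // scale1r.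
apply: invertibleZ => //; apply: invertible_1B.
have : 0 < complex.Re `|z| by apply: le_lt_trans lt; exact: cnorm_ge0.
move=> zgt; rewrite cnormZ normfV.
have -> : complex.Re `|z|^-1 = (complex.Re `|z|)^-1.
  by apply: complexI; rewrite -normfV normC_Re real_complexV normC_Re normfV.
by rewrite mulrC ltr_pdivrMr ?mul1r.
Qed.

Lemma spectrumD x z c : spectrum x z -> spectrum (x + c%:A) (z + c).
Proof. by rewrite /spectrum /= scalerDl opprD addrACA subrr addr0. Qed.

(* [z + i t] is in the spectrum of [h + i t], whose squared norm is at most
   [|h|^2 + t^2], for every real [t]. *)
Lemma spectrum_sa_real h z : star h = h -> spectrum h z -> complex.Im z = 0.
Proof.
move=> sh hz; apply/eqP/negPn/negP => b0.
(* The two bounds leave (Im z)^2 + 2 t Im z <= |h|^2; this [t] makes 2 t Im z equal to |h|^2 + 1. *)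
pose t := (cnorm h ^+ 2 + 1) / (2 * complex.Im z).
have := spectrum_bound (spectrumD (c := t *i) hz).
rewrite -ler_sqr ?nnegrE ?Re_norm_ge0 ?cnorm_ge0 // sqr_Re_norm.
have -> : cnorm (h + (t *i)%:A) ^+ 2 = cnorm (h ^+ 2 + (t ^+ 2)%:C%:A).
  rewrite -cnorm_star; congr cnorm; rewrite starD sh starZ star1.
  have -> : ((t *i)^*)%R = - (t *i) :> R[i].
    by apply/eqP; rewrite eq_complex /= oppr0 !eqxx.
  have -> : (t ^+ 2)%:C = - ((t *i) * (t *i)) :> R[i].
    by apply/eqP; rewrite eq_complex /=; apply/andP; split; apply/eqP; ring.
  have vh : h * (t *i)%:A = (t *i)%:A * h by rewrite -scalerAl -scalerAr mul1r mulr1.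
  have vv : (t *i * t *i)%:A = (t *i)%:A * (t *i)%:A :> A.
    by rewrite -scalerA -scalerAl mul1r.
  rewrite !scaleNr vv; move: (t *i)%:A vh => v vh.
  by rewrite mulrDr !mulrDl vh; ncring.
have := cnormD (h ^+ 2) (t ^+ 2)%:C%:A.
rewrite cnorm_sqr_sa // cnormZr cnorm1 mulr1 ger0_norm ?sqr_ge0 //.
have : t * (2 * complex.Im z) = cnorm h ^+ 2 + 1.
  by rewrite /t divfK // mulf_neq0 // pnatr_eq0.
rewrite raddfD raddfD /= addr0 => e1 e2 e3.
have := sqr_ge0 (complex.Re z); have := sqr_ge0 (complex.Im z).
move: (cnorm h ^+ 2) e1 e2 e3 => k e1 e2 e3; nra.
Qed.

(** With w^2 = z, z - h^2 factors as (w - h) (w + h), so [w] or [- w] is in the spectrum of [h].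
    That number is real, hence z is the square of a real number. *)
Lemma positive_sqr h : star h = h -> positive (h ^+ 2).
Proof.
move=> sh; split; first by rewrite starX sh.
move=> z hz; pose w := sqrtC z.
have ez : z%:A - h ^+ 2 = (w%:A - h) * - ((- w)%:A - h).
  rewrite -[in LHS](sqrtCK z) -/w expr2 -scalerA scaleNr.
  have -> : w *: (w *: 1) = (w *: 1) * (w *: 1) :> A.
    by rewrite -scalerAl mul1r.
  have : (w *: 1) * h = h * (w *: 1) by rewrite -scalerAl -scalerAr mul1r mulr1.
  move: (w *: 1 : A) => v vh; rewrite opprB opprK mulrDr !mulrBl vh.
  by ncring.
have [w1|w1] : spectrum h w \/ spectrum h (- w).
- apply: contrapT => /not_orP[/contrapT i1 /contrapT i2]; apply: hz.
  by rewrite ez; apply: invertibleM => //; exact: invertibleN.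
- have := spectrum_sa_real sh w1; rewrite -[z]sqrtCK -/w => wi.
  have -> : w = (complex.Re w)%:C by rewrite [LHS]complexE wi mulr0 addr0.
  by rewrite -rmorphXn lecR sqr_ge0.
- have := spectrum_sa_real sh w1; rewrite -[z]sqrtCK -/w => wi.
  rewrite -sqrrN; have -> : - w = (complex.Re (- w))%:C by rewrite [LHS]complexE wi mulr0 addr0.
  by rewrite -rmorphXn lecR sqr_ge0.
Qed.

(* [f] is the real part of [x = f + i w], and [star x * x = t]. *)
Lemma norm_le_of_sum_sqr (f w : A) t : star f = f -> star w = w ->
  f * w = w * f -> f ^+ 2 + w ^+ 2 = t%:C%:A -> cnorm f ^+ 2 <= `|t|.
Proof.
move=> sf sw fw e; pose x := f + 'i *: w.
have si : (('i : R[i])^*)%R = - 'i by apply/eqP; rewrite eq_complex /= oppr0 !eqxx.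
have sx : star x = f - 'i *: w by rewrite starD sf starZ sw si scaleNr.
have xx : star x * x = t%:C%:A.
  rewrite sx -e mulrBl !mulrDr -!scalerAl -!scalerAr fw scalerA.
  have -> : ('i : R[i]) * 'i = -1 by rewrite -expr2 sqr_i.
  by rewrite scaleN1r; ncring.
have nx : cnorm x ^+ 2 = `|t| by rewrite -cnorm_star xx cnormZr cnorm1 mulr1.
rewrite -nx ler_sqr ?nnegrE ?cnorm_ge0 //.
have -> : f = 2^-1%:C *: (x + star x).
  by rewrite sx addrACA subrr addr0 halfD.
rewrite cnormZr ger0_norm ?invr_ge0 //.
by have := cnormD x (star x); rewrite cnorm_starE; lra.
Qed.

(* If [|h| = 1] and [1 - h^2] is invertible, then [1 - h^2 = w^2] dominates some
   [e > 0], so [1 - e - h^2] is a square as well, which forces [|h|^2 <= 1 - e]. *)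
Lemma norm_in_spectrum h : star h = h -> h != 0 ->
  spectrum h (cnorm h)%:C \/ spectrum h (- cnorm h)%:C.
Proof.
move=> sh h0; apply: contrapT => /not_orP[/contrapT i1 /contrapT i2].
have nh0 : 0 < cnorm h.
  by rewrite lt_neqAle cnorm_ge0 andbT eq_sym; apply: contra_neq h0; exact: cnorm0_eq0.
pose k : A := (cnorm h)^-1%:C *: h.
have sk : star k = k by rewrite starZr sh.
have nk : cnorm k = 1 by rewrite cnormZr ger0_norm ?invr_ge0 ?cnorm_ge0 // mulVf // gt_eqF.
have cz : (cnorm h)^-1%:C != 0 :> R[i] by rewrite eq_complex /= eqxx andbT invr_eq0 gt_eqF.
have cV : (cnorm h)^-1%:C * (cnorm h)%:C = 1 :> R[i] by rewrite -rmorphM /= mulVf ?gt_eqF.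
have j1 : invertible (1 - k).
  by have := invertibleZ cz i1; rewrite scalerBr scalerA cV scale1r.
have j2 : invertible (1 + k).
  have := invertibleN (invertibleZ cz i2).
  by rewrite rmorphN /= scaleNr -opprD scalerN opprK scalerDr scalerA cV scale1r.
clearbody k; have [v [sv1 sv2]] : invertible (1 - k ^+ 2).
  by rewrite (_ : _ - _ = (1 - k) * (1 + k)); [exact: invertibleM | ncring].
have [||w [sw ww wc]] := @sqrt_1B R A (k ^+ 2).
- by rewrite starX sk.
- by rewrite cnorm_sqr_sa // nk expr1n.
have sv : star v = v.
  have e : star v * (1 - k ^+ 2) = 1.
    by have := congr1 star sv1; rewrite starM starB star1 starX sk.
  by rewrite -[LHS]mulr1 -[X in _ * X]sv1 mulrA e mul1r.
(* This [e] gives |e v| <= 1, so 1 - e v = s^2. As v inverts 1 - k^2 = w^2, one gets (w s)^2 = 1 -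
   k^2 - e. *)
pose e := (cnorm v + 1)^-1.
have v0 := cnorm_ge0 v.
have e0 : 0 < e by rewrite invr_gt0; lra.
have e1 : e <= 1 by rewrite invf_le1 //; lra.
have nev : cnorm (e%:C *: v) <= 1.
  by rewrite cnormZr gtr0_norm // mulrC ler_pdivrMr; lra.
have [|s [ss s2 sc]] := @sqrt_1B R A (e%:C *: v) _ nev; first by rewrite starZr sv.
have kv : k * v = v * k.
  have kk : k * (1 - k ^+ 2) = (1 - k ^+ 2) * k by ncring.
  by rewrite -[LHS]mul1r -sv2 -mulrA [(1 - _) * _]mulrA -kk -!mulrA sv1 mulr1 .
have wv : w * v = v * w.
  have kk : w * (1 - k ^+ 2) = (1 - k ^+ 2) * w by rewrite -ww; ncring.
  by rewrite -[LHS]mul1r -sv2 -mulrA [(1 - _) * _]mulrA -kk -!mulrA sv1 mulr1 .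
have sw' : w * s = s * w by apply: sc; rewrite -scalerAl -scalerAr wv.
have ks : k * s = s * k by apply: sc; rewrite -scalerAl -scalerAr kv.
have kw : k * w = w * k by apply: wc; ncring.
have := @norm_le_of_sum_sqr k (w * s) (1 - e).
rewrite nk expr1n sk starM ss sw -sw' => /(_ erefl erefl).
have -> : (w * s) ^+ 2 = w ^+ 2 * s ^+ 2.
  by rewrite !expr2 -!mulrA (mulrA s) -sw' !mulrA.
rewrite s2 ww mulrBr mulr1 -scalerAr sv1 rmorphB /= scalerBl scale1r.
rewrite addrA [k ^+ 2 + _]addrC subrK => /(_ _ erefl).
rewrite ger0_norm ?subr_ge0 // => H.
suff : 1 <= 1 - e by lra.
by apply: H; rewrite mulrA kw -mulrA ks mulrA.
Qed.

Lemma sa_norm_le h r : star h = h -> 0 <= r ->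
  (forall t, spectrum h t%:C -> `|t| <= r) -> cnorm h <= r.
Proof.
move=> sh r0 H; have [->|h0] := eqVneq h 0; first by rewrite cnorm0.
by case: (norm_in_spectrum sh h0) => /H; rewrite ?normrN ger0_norm ?cnorm_ge0.
Qed.

Lemma spectrum_sa_neq0 h : star h = h -> exists t, spectrum h t%:C.
Proof.
move=> sh; have [->|h0] := eqVneq h 0.
  exists 0; rewrite /spectrum /= scale0r subr0 => -[y [/eqP]].
  by rewrite mul0r eq_sym oner_eq0.
by case: (norm_in_spectrum sh h0) => H; eexists; exact: H.
Qed.

(** Factoring out z - x leaves 1 - (z - c) y, a small perturbation of 1. This makes the spectrum
    closed, as compactness requires. *)
Lemma spectrum_open x z : ~ spectrum x z ->
  exists2 e : R, 0 < e & forall c, complex.Re `|c - z| < e -> ~ spectrum x c.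
Proof.
move=> /contrapT [y [xy yx]]; have y0 := cnorm_ge0 y.
exists (cnorm y + 1)^-1; first by rewrite invr_gt0; lra.
move=> c cz; apply.
have -> : c%:A - x = (z%:A - x) * (1 - (z - c) *: y).
  rewrite mulrBr mulr1 -scalerAr xy scalerBl.
  by ncring.
apply: invertibleM; first by exists y.
apply: invertible_1B; rewrite cnormZ distrC.
have : complex.Re `|c - z| * (cnorm y + 1) < 1.
  by rewrite -ltr_pdivlMr ?mul1r //; lra.
by have := Re_norm_ge0 (c - z); nra.
Qed.

End Spectrum.

(** * Polynomials in a selfadjoint element *)

Section PolynomialCalculus.
Context {R : realType} {A : cstarAlgType R}.
Variables (a : A) (sa : star a = a).
Implicit Types (p q : {poly R[i]}) (z w : R[i]) (r t : R).

Lemma conj_rc t : (t%:C^*)%R = t%:C.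
Proof. by rewrite conj_Creal ?complex_real. Qed.

Lemma star_horner_alg p : star (horner_alg a p) = horner_alg a (map_poly Num.conj p).
Proof.
elim/poly_ind: p => [|p c IH]; first by rewrite map_poly0 !rmorph0 star0.
rewrite !rmorphD !rmorphM /= map_polyX map_polyC /= !horner_algX !horner_algC.
rewrite starD starM starZ star1 sa IH; congr (_ + _).
by rewrite -{1}(horner_algX a) -rmorphM mulrC rmorphM /= horner_algX.
Qed.

(** [p] splits into linear factors over [R[i]], and each factor has its root outside the
    spectrum. *)
Lemma invertible_horner_alg p : p != 0 ->
  (forall w, spectrum a w -> ~~ root p w) -> invertible (horner_alg a p).
Proof.
move=> p0 H; have [s e] := closed_field_poly_normal p.
have {H} : forall w, w \in s -> ~ spectrum a w.
  move=> w ws /H/negP; apply; rewrite e rootZ ?lead_coef_eq0 //.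
  by rewrite root_prod_XsubC.
rewrite e => {e} H; rewrite linearZ /= mulr_algl.
apply: invertibleZ; first by rewrite lead_coef_eq0.
elim: s H => [|w s IH] H; first by rewrite big_nil rmorph1; exists 1; rewrite mulr1.
rewrite big_cons rmorphM /=; apply: invertibleM; last first.
  by apply: IH => v vs; apply: H; rewrite inE vs orbT.
rewrite rmorphB /= horner_algX horner_algC -opprB; apply: invertibleN.
by apply: contrapT; apply: H; rewrite inE eqxx.
Qed.

Lemma spectrum_horner_alg p z : spectrum (horner_alg a p) z ->
  exists2 w, spectrum a w & p.[w] = z.
Proof.
(* If [p] is the constant [z], any point of the spectrum will do, so it must be nonempty. *)
move=> pz; have [e|q0] := eqVneq (p - z%:P) 0.
  have [t at_] := spectrum_sa_neq0 sa; exists t%:C => //.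
  by rewrite (eqP (_ : p == z%:P)) ?hornerC // -subr_eq0 e.
apply: contrapT => H; apply: pz; rewrite -opprB; apply: invertibleN.
have := @invertible_horner_alg _ q0; rewrite rmorphB /= horner_algC; apply.
move=> w aw; apply/negP; rewrite /root !hornerE subr_eq0 => /eqP e.
by apply: H; exists w.
Qed.

Lemma spectrum_real w : spectrum a w -> w = (complex.Re w)%:C.
Proof. by move=> aw; rewrite [LHS]complexE (spectrum_sa_real sa aw) mulr0 addr0. Qed.

(** The C*-identity passes to the selfadjoint element [star p(a) * p(a)], a polynomial in [a] that
    equals |p|^2 on the real spectrum. Spectral mapping and [sa_norm_le] then apply. *)
Lemma cnorm_horner_alg p r : 0 <= r ->
  (forall t, spectrum a t%:C -> complex.Re `|p.[t%:C]| <= r) ->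
  cnorm (horner_alg a p) <= r.
Proof.
move=> r0 H; rewrite -ler_sqr ?nnegrE ?cnorm_ge0 // -cnorm_star.
have e : star (horner_alg a p) * horner_alg a p = horner_alg a (map_poly Num.conj p * p).
  by rewrite star_horner_alg rmorphM.
rewrite e; apply: sa_norm_le; rewrite ?sqr_ge0 //; first by rewrite -e starM starK.
move=> s /spectrum_horner_alg [w aw].
have wE := spectrum_real aw; rewrite wE in aw *; move: (complex.Re w) aw => t at_ {w wE}.
rewrite hornerM -[X in _.[X] * _](conj_rc t) horner_map /=.
rewrite mulrC -normCK => es.
have -> : s = complex.Re `|p.[t%:C]| ^+ 2.
  by apply: complexI; rewrite -es -normC_Re -rmorphXn.
rewrite ger0_norm ?sqr_ge0 //.
by rewrite ler_sqr ?nnegrE ?Re_norm_ge0 ?H.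
Qed.

End PolynomialCalculus.

(** * Polynomial approximation on the line *)

Section PartitionOfUnity.
Context {R : realType}.
Local Notation rabs := (@Num.norm R R).
Implicit Types (s t x : R) (K : set R) (f : R -> R[i]).

(** The clamp of [x] to [0, 1], written with absolute values because these are approximated by
    polynomials in [approximable_abs]. *)
Definition ramp x : R := 2^-1 * (rabs x - rabs (x - 1) + 1).

Lemma ramp_le0 x : x <= 0 -> ramp x = 0.
Proof. by move=> x0; rewrite /ramp !ler0_norm; lra. Qed.

Lemma ramp_ge1 x : 1 <= x -> ramp x = 1.
Proof. by move=> x0; rewrite /ramp !ger0_norm; lra. Qed.

Lemma ramp_nondecreasing x y : x <= y -> ramp x <= ramp y.
Proof.
move=> xy; rewrite /ramp.
by case: (ger0P x) => ?; case: (ger0P y) => ?; case: (ger0P (x - 1)) => ?;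
  case: (ger0P (y - 1)) => ?; lra.
Qed.

(* Bump of half-width [d] around [(i - b) d]; consecutive bumps telescope to 1. *)
Definition hat (d b : R) i t : R := ramp (t / d + (b - i + 1)) - ramp (t / d + (b - i)).

Lemma partition_of_unity K (M d : R) : (forall t, K t -> rabs t <= M) -> 0 < d ->
  exists n (b : R) (s : nat -> R),
  [/\ forall i t, 0 <= hat d b i t,
      forall t, K t -> \sum_(i < n) hat d b i%:R t = 1 &
      forall (i : nat) t, K t -> hat d b i%:R t != 0 -> K (s i) /\ rabs (t - s i) < 2 * d].
Proof.
move=> KM d0.
(* The hats telescope to a difference of two ramps; this [n] is large enough for the second one to
   vanish up to t = M. *)
have [n nM] : exists n : nat, 2 * M / d + 1 < n%:R.
  by eexists; exact: (truncnS_gt (2 * M / d + 1)).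
exists n, (M / d).
pose c i := i * d - M.
(* [s i] is a point of [K] within [d] of the centre [c i]. Where there is none, the default 0 is
   harmless: the hat then vanishes on [K]. *)
exists (fun i => xget 0 [set s | K s /\ rabs (s - c i%:R) < d]%classic); split.
- by move=> i t; rewrite subr_ge0 ramp_nondecreasing //; lra.
- move=> t /KM; rewrite ler_norml => /andP[t1 t2].
  have tel m : \sum_(i < m) hat d (M / d) i%:R t =
      ramp (t / d + (M / d + 1)) - ramp (t / d + (M / d + 1 - m%:R)).
    elim: m => [|m IH]; first by rewrite big_ord0 subr0 subrr.
    rewrite big_ord_recr /= IH /hat -natr1.
    have -> : t / d + (M / d + 1 - (m%:R + 1)) = t / d + (M / d - m%:R) by ring.
    have -> : t / d + (M / d - m%:R + 1) = t / d + (M / d + 1 - m%:R) by ring.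
    by ring.
  rewrite tel ramp_ge1 ?ramp_le0 ?subr0 //.
    have : t / d <= M / d by rewrite ler_pM2r ?invr_gt0.
    lra.
  have : (- M) / d <= t / d by rewrite ler_pM2r ?invr_gt0.
  lra.
- move=> i t Kt ht.
  have tc : rabs (t - c i%:R) < d.
    have e : t / d + (M / d - i%:R) = (t - c i%:R) / d.
      by rewrite /c; field; rewrite gt_eqF.
    move: ht; rewrite /hat addrA e addrC subr_eq0 => ht.
    rewrite ltr_norml; apply/andP; split; rewrite ltNge; apply: contra ht => h.
    - have : (t - c i%:R) / d <= -1 by rewrite ler_pdivrMr // mulN1r.
      by move=> ?; rewrite !ramp_le0 //; lra.
    - have : 1 <= (t - c i%:R) / d by rewrite ler_pdivlMr // mul1r.
      by move=> ?; rewrite !ramp_ge1 //; lra.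
  have : exists s, K s /\ rabs (s - c i%:R) < d by exists t.
  move=> /xgetPex - /(_ 0); set s := xget _ _ => -[Ks sc]; split=> //.
  have -> : t - s = (t - c i%:R) - (s - c i%:R) by ring.
  by apply: le_lt_trans (ler_normB _ _) _; lra.
Qed.

(** Heine-Cantor: by Bolzano-Weierstrass, pairs violating uniformity accumulate at some l in [K],
    and the triangle inequality through l is contradicted. An abstract [D] covers complex functions,
    real functions and finite families. *)
Lemma uniform_on_compact K (D : R -> R -> R) (M : R) :
  (forall t, K t -> rabs t <= M) ->
  (forall l : R, (forall d : R, 0 < d -> exists2 t, K t & rabs (t - l) < d) -> K l) ->
  (forall r s t, D s t <= D r s + D r t) ->
  (forall l, K l -> forall e : R, 0 < e -> exists2 d : R, 0 < d &
     forall t, K t -> rabs (t - l) < d -> D l t < e) ->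
  forall e : R, 0 < e -> exists2 d : R, 0 < d &
     forall s t, K s -> K t -> rabs (s - t) < d -> D s t < e.
Proof.
move=> KM Kc Dt Dc e e0; apply: contrapT => H.
have {H} H n : exists st : R * R,
    [/\ K st.1, K st.2, rabs (st.1 - st.2) < n.+1%:R^-1 & e <= D st.1 st.2].
  apply: contrapT => Hn; apply: H; exists n.+1%:R^-1; first by rewrite invr_gt0.
  move=> s t Ks Kt st; rewrite ltNge; apply/negP => es.
  by apply: Hn; exists (s, t).
have [u uP] := choice H.
have [|f fi cf] := @bolzano_weierstrass R (fun n => (u n).1).
  exists M; split=> [|x Mx n _ /=]; first exact: num_real.
  by have [/KM ? _ _ _] := uP n; apply: le_trans (ltW Mx).
have near (l d : R) : 0 < d -> (fun n => (u (f n)).1) @ \oo --> l ->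
    exists N, forall n, (N <= n)%N -> rabs ((u (f n)).1 - l) < d.
  move=> d0 /cvgrPdist_lt /(_ _ d0) [N _ NP]; exists N => n /NP /=.
  by rewrite distrC.
have {cf} [l lP] : exists l : R, (fun n => (u (f n)).1) @ \oo --> l.
  by exists (lim (((fun n => (u n).1) \o f) @ \oo)).
have Kl : K l.
  apply: Kc => d d0; have [N NP] := near _ _ d0 lP.
  by exists (u (f N)).1; [have [] := uP (f N)|exact: NP].
have e2 : 0 < e / 2 by rewrite divr_gt0.
have [d d0 dP] := Dc _ Kl _ e2.
have d2 : 0 < d / 2 by rewrite divr_gt0.
have [N NP] := near _ _ d2 lP.
have fge n : (n <= f n)%N.
  elim: n => // n IH; apply: leq_ltn_trans IH _.
  by rewrite ltnNge -leEnat fi ltnn.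
have [m mP] : exists m : nat, (d / 2)^-1 < m%:R.
  by eexists; exact: (truncnS_gt _).
pose n := maxn N m.
have [K1 K2 h1 h2] := uP (f n).
have h3 := NP n (leq_maxl _ _).
have h4 : (f n).+1%:R^-1 <= d / 2.
  rewrite -[leRHS]invrK lef_pV2 ?posrE ?invr_gt0 //.
  apply: le_trans (ltW mP) _; rewrite ler_nat.
  by apply: leq_trans (leq_maxr N m) (leq_trans (fge _) (leqnSn _)).
have h5 : D l (u (f n)).1 < e / 2 by apply: dP => //; lra.
have {h1} h1 := lt_le_trans h1 h4.
have h6 : D l (u (f n)).2 < e / 2.
  apply: dP => //.
  have -> : (u (f n)).2 - l = ((u (f n)).1 - l) - ((u (f n)).1 - (u (f n)).2) by ring.
  by apply: le_lt_trans (ler_normB _ _) _; clear -h1 h3; lra.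
by have := Dt l (u (f n)).1 (u (f n)).2; lra.
Qed.

Definition polynomially_approximable K f := forall e : R, 0 < e ->
  exists p : {poly R[i]}, forall t, K t -> complex.Re `|f t - p.[t%:C]| <= e.

Lemma Re_normD (z w : R[i]) : complex.Re `|z + w| <= complex.Re `|z| + complex.Re `|w|.
Proof. by rewrite -lecR rmorphD /= !normC_Re ler_normD. Qed.

Lemma Re_normM (z w : R[i]) : complex.Re `|z * w| = complex.Re `|z| * complex.Re `|w|.
Proof. by apply: complexI; rewrite rmorphM /= !normC_Re normrM. Qed.

Lemma Re_norm_rc x : complex.Re `|x%:C| = rabs x.
Proof. by rewrite normc_def /= expr0n /= addr0 sqrtr_sqr. Qed.

Lemma approximableD K f g : polynomially_approximable K f ->
  polynomially_approximable K g -> polynomially_approximable K (fun t => f t + g t).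
Proof.
move=> Hf Hg e e0; have e2 : 0 < e / 2 by rewrite divr_gt0.
have [p pP] := Hf _ e2; have [q qP] := Hg _ e2; exists (p + q) => t Kt.
rewrite hornerD opprD addrACA; have := Re_normD (f t - p.[t%:C]) (g t - q.[t%:C]).
by have := pP _ Kt; have := qP _ Kt; lra.
Qed.

Lemma approximable_poly K (p : {poly R[i]}) :
  polynomially_approximable K (fun t => p.[t%:C]).
Proof. by move=> e e0; exists p => t _; rewrite subrr normr0 ltW. Qed.

Lemma approximableZ K (c : R[i]) f : polynomially_approximable K f ->
  polynomially_approximable K (fun t => c * f t).
Proof.
move=> Hf e e0; have c0 : 0 <= complex.Re `|c| := Re_norm_ge0 c.
have [|p pP] := Hf (e / (complex.Re `|c| + 1)); first by rewrite divr_gt0 //; lra.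
exists (c *: p) => t Kt; rewrite hornerZ -mulrBr Re_normM.
have := pP _ Kt; rewrite ler_pdivlMr; last lra.
by have := Re_norm_ge0 (f t - p.[t%:C]); nra.
Qed.

Lemma approximable_eq K f g : f =1 g ->
  polynomially_approximable K f -> polynomially_approximable K g.
Proof. by move=> /funext ->. Qed.

Lemma approximable_sum K n (F : nat -> R -> R[i]) :
  (forall i, polynomially_approximable K (F i)) ->
  polynomially_approximable K (fun t => \sum_(i < n) F i t).
Proof.
move=> H; elim: n => [|n IH].
  by apply: approximable_eq (approximable_poly K 0) => t; rewrite big_ord0 horner0.
by apply: approximable_eq (approximableD IH (H n)) => t; rewrite big_ord_recr.
Qed.

(** The iteration of [sqrt_1B] with 1 - x^2 for its argument tends to 1 - |x| for |x| <= 1. Its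
    error d satisfies d' <= d (1 - d / 2), which gives (n + 1) d <= 2, a rate uniform in x. [B]
    rescales the affine argument into [-1, 1]. *)
Lemma approximable_abs K (M al be : R) : (forall t, K t -> rabs t <= M) ->
  polynomially_approximable K (fun t => (rabs (al * t + be))%:C).
Proof.
move=> KM e e0; pose B := rabs al * rabs M + rabs be + 1.
have B0 : 0 < B.
  have := mulr_ge0 (normr_ge0 al) (normr_ge0 M); have := normr_ge0 be.
  by rewrite /B; lra.
pose v := fix v n x : R := if n is m.+1 then 2^-1 * (1 - x * x + v m x * v m x) else 0.
pose L : {poly R[i]} := (al / B)%:C *: 'X + ((be / B)%:C)%:P.
pose y := fix y n : {poly R[i]} :=
  if n is m.+1 then 2^-1%:C *: (1 - L * L + y m * y m) else 0.
have yE n t : (y n).[t%:C] = (v n ((al * t + be) / B))%:C.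
  elim: n => [|n IH] /=; first by rewrite horner0.
  rewrite hornerZ !hornerD hornerN !hornerM IH hornerC hornerD hornerZ hornerX hornerC.
  have -> : (al / B)%:C * t%:C + (be / B)%:C = ((al * t + be) / B)%:C :> R[i].
    by rewrite -real_complexM -real_complexD; congr (_%:C); ring.
  move: ((al * t + be) / B) => x; move: (v n x) => w.
  by rewrite real_complexM real_complexD real_complexB !real_complexM.
have ve n x : rabs x <= 1 ->
    0 <= 1 - rabs x - v n x <= 1 - rabs x /\ n.+1%:R * (1 - rabs x - v n x) <= 2.
  move=> x1; have x0 := normr_ge0 x.
  have xx : x * x = rabs x * rabs x by rewrite -!expr2 real_normK ?num_real.
  elim: n => [|n [/andP[h1 h2] h3]] /=; first by split; [apply/andP; split|]; lra.
  rewrite {}xx; move: (v n x) (rabs x) x1 x0 h1 h2 h3 => w Y x1 x0 h1 h2 h3.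
  split; first by apply/andP; split; nra.
  rewrite -natr1; set k : R := n.+1%:R in h3 *.
  have k1 : 1 <= k by rewrite ler1n.
  set d := 1 - Y - w in h1 h2 h3; have wE : w = 1 - Y - d by rewrite /d; ring.
  have d1 : d <= 1 by lra.
  have -> : 1 - Y - 2^-1 * (1 - Y * Y + w * w) = d * (1 - Y) - d * d / 2.
    by rewrite wE; field.
  have l1 : d * (1 - Y) - d * d / 2 <= d * (1 - d / 2) by nra.
  have l2 : (k + 1) * (d * (1 - d / 2)) <= (2 + d) * (1 - d / 2).
    by rewrite mulrA ler_wpM2r //; lra.
  have l3 : (2 + d) * (1 - d / 2) <= 2 by nra.
  by apply: le_trans l3; apply: le_trans l2; rewrite ler_wpM2l //; lra.
have [n nP] : exists n : nat, 2 * B / e < n%:R by eexists; exact: (truncnS_gt _).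
exists (B%:C *: (1 - y n)) => t Kt.
rewrite hornerZ hornerD hornerN yE hornerC.
set x := (al * t + be) / B.
have x1 : rabs x <= 1.
  rewrite normrM normfV (gtr0_norm B0) ler_pdivrMr // mul1r.
  apply: le_trans (ler_normD _ _) _; rewrite normrM.
  have := KM _ Kt; have := ler_norm M; have := normr_ge0 al; rewrite /B.
  by have := normr_ge0 t; nra.
have -> : rabs (al * t + be) = B * rabs x.
  by rewrite /x normrM normfV (gtr0_norm B0); field; rewrite gt_eqF.
rewrite -[1]/(1%:C) -real_complexB -real_complexM -real_complexB Re_norm_rc.
have [/andP[h1 _] h2] := ve n x x1.
have -> : B * rabs x - B * (1 - v n x) = - (B * (1 - rabs x - v n x)) by ring.
rewrite normrN ger0_norm ?mulr_ge0 ?(ltW B0) //.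
move: nP; rewrite ltr_pdivrMr // => nP.
move: h2; rewrite -natr1; set d := 1 - _ - _ in h1 *; set k : R := n%:R in nP *.
move=> h2; have k0 : 0 <= k by exact: ler0n.
have kd : k * d <= 2 by nra.
have : k * (B * d) <= k * e by nra.
have [k1|] := ltP 0 k; first by rewrite ler_pM2l.
by nra.
Qed.

Lemma approximable_hat K (M d b i : R) : (forall t, K t -> rabs t <= M) ->
  polynomially_approximable K (fun t => (hat d b i t)%:C).
Proof.
move=> KM; have ab be := @approximable_abs K M d^-1 be KM.
have ra be : polynomially_approximable K (fun t => (ramp (d^-1 * t + be))%:C).
  have := approximableZ 2^-1%:C (approximableD (approximableD (ab be)
    (approximableZ (-1) (ab (be - 1)))) (approximable_poly K 1)).
  apply: approximable_eq => t; rewrite hornerC /ramp mulN1r addrA.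
  by rewrite real_complexM !real_complexD real_complexN.
have := approximableD (ra (b - i + 1)) (approximableZ (-1) (ra (b - i))).
apply: approximable_eq => t; rewrite /hat mulN1r real_complexB.
by rewrite [t / d]mulrC.
Qed.

(** [f] is replaced by the combination of hats with coefficients f(s i), [s i] in [K]; at t the
    error averages f t - f (s i) over the hats that do not vanish there. Hats are combinations of
    absolute values, hence approximable. *)
Lemma weierstrass K (M : R) f : (forall t, K t -> rabs t <= M) ->
  (forall e : R, 0 < e -> exists2 d : R, 0 < d &
     forall s t, K s -> K t -> rabs (s - t) < d -> complex.Re `|f s - f t| < e) ->
  polynomially_approximable K f.
Proof.
move=> KM fu e e0; have e2 : 0 < e / 2 by rewrite divr_gt0.
have [d d0 dP] := fu _ e2; have d2 : 0 < d / 2 by rewrite divr_gt0.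
have [n [b [s [h0 h1 hs]]]] := partition_of_unity KM d2.
have ag : polynomially_approximable K
    (fun t => \sum_(i < n) f (s i) * (hat (d / 2) b i%:R t)%:C).
  apply: (@approximable_sum _ _ (fun i t => f (s i) * (hat (d / 2) b i%:R t)%:C)) => i.
  exact: approximableZ (approximable_hat _ _ _ KM).
have [p pP] := ag _ e2; exists p => t Kt; have := pP _ Kt.
set g := \sum_(i < n) _; suff : complex.Re `|f t - g| <= e / 2.
  have := Re_normD (f t - g) (g - p.[t%:C]); rewrite addrA subrK; lra.
have -> : f t - g = \sum_(i < n) (f t - f (s i)) * (hat (d / 2) b i%:R t)%:C.
  under eq_bigr => i _ do rewrite mulrBl.
  rewrite sumrB -mulr_sumr; congr (_ - _).
  by rewrite -real_complex_sum h1 // mulr1.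
apply: (@le_trans _ _ (\sum_(i < n) e / 2 * hat (d / 2) b i%:R t)); last first.
  by rewrite -mulr_sumr h1 // mulr1.
rewrite -lecR normC_Re; apply: le_trans (ler_norm_sum _ _ _) _.
rewrite real_complex_sum; apply: ler_sum => i _ /=.
rewrite -normC_Re lecR Re_normM Re_norm_rc (ger0_norm (h0 _ _)).
have [->|/(hs i _ Kt) [Ks st]] := eqVneq (hat (d / 2) b i%:R t) 0; first by rewrite !mulr0.
by rewrite ler_wpM2r // ltW // dP //; lra.
Qed.

End PartitionOfUnity.

(** * Existence of the functional calculus *)

Section FunctionalCalculus.
Context {R : realType} {A : cstarAlgType R}.
Local Notation rabs := (@Num.norm R R).
Local Notation cabsr z := (complex.Re `|z|).
Implicit Types (a x y : A) (f g : R[i]^o -> R[i]^o) (p q : {poly R[i]}).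

Lemma cont_spectrumP a f : cont_spectrum a f <->
  forall z, spectrum a z -> forall e : R, 0 < e -> exists2 d : R, 0 < d &
    forall w, spectrum a w -> cabsr (w - z) < d -> cabsr (f w - f z) < e.
Proof.
(* Radii of balls in [R[i]] are themselves complex; being positive, they are real. *)
have lt0C (r : R[i]) : 0 < r -> r = (complex.Re r)%:C /\ 0 < complex.Re r.
  by case: r => r s; rewrite ltcE /= => /andP[/eqP -> ?].
split=> [/subspace_continuousP fc z az e e0|H].
  have /cvgrPdist_lt /(_ e%:C) := fc z az.
  rewrite ltcR => /(_ e0) /nbhs_ballP [d /lt0C [dE d0] dP].
  exists (complex.Re d) => // w aw wz.
  have /(_ aw) : spectrum a w -> `|f z - f w| < e%:C.
    by apply: dP; rewrite -ball_normE /= distrC dE -normC_Re ltcR.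
  by rewrite distrC -normC_Re ltcR.
apply/subspace_continuousP => z az; apply/cvgrPdist_lt => e /lt0C [-> e0].
have [d d0 dP] := H z az _ e0.
apply/nbhs_ballP; exists d%:C; first by rewrite /= ltcR.
move=> w; rewrite -ball_normE /= => zw aw.
by rewrite distrC -normC_Re ltcR dP // -ltcR normC_Re distrC.
Qed.

Section Selfadjoint.
Variables (a : A) (sa : star a = a).

Let K : set R := [set t | spectrum a t%:C].

Let K_bounded t : K t -> rabs t <= cnorm a.
Proof. by move=> /spectrum_bound; rewrite Re_norm_rc. Qed.

Let K_closed (l : R) : (forall d : R, 0 < d -> exists2 t, K t & rabs (t - l) < d) -> K l.
Proof.
move=> H; apply: contrapT => /spectrum_open [e e0 eP].
have [t Kt tl] := H _ e0; apply: eP Kt.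
by rewrite -real_complexB Re_norm_rc.
Qed.

Lemma approximable_cont f : cont_spectrum a f ->
  polynomially_approximable K (fun t => f t%:C).
Proof.
move=> /cont_spectrumP fc; apply: weierstrass K_bounded _.
apply: (@uniform_on_compact R K (fun s t => cabsr (f s%:C - f t%:C))) K_bounded K_closed _ _.
  move=> r s t; have := Re_normD (f s%:C - f r%:C) (f r%:C - f t%:C).
  rewrite addrA subrK => H; apply: le_trans H _.
  by rewrite [`|f s%:C - _|]distrC.
move=> l Kl e e0; have [d d0 dP] := fc _ Kl _ e0.
exists d => // t Kt tl; rewrite distrC; apply: dP => //.
by rewrite -real_complexB Re_norm_rc.
Qed.

Let poly_bounded p : exists2 B : R, 0 <= B & forall t, K t -> cabsr p.[t%:C] <= B.
Proof.
elim/poly_ind: p => [|p c [B B0 BP]].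
  by exists 0 => // t _; rewrite horner0 normr0.
exists (B * cnorm a + cabsr c) => [|t Kt].
  by rewrite addr_ge0 ?mulr_ge0 ?cnorm_ge0 ?Re_norm_ge0.
rewrite !hornerE; apply: le_trans (Re_normD _ _) _; rewrite lerD2r Re_normM Re_norm_rc.
by apply: ler_pM; rewrite ?Re_norm_ge0 ?BP ?K_bounded.
Qed.

(* [x] is the value at [a] of a function [f] on the spectrum of [a]. *)
Let calc f x := forall e : R, 0 < e -> exists p,
  (forall t, K t -> cabsr (f t%:C - p.[t%:C]) <= e) /\
  cnorm (x - horner_alg a p) <= e.

Let calc_norm f x r : 0 <= r -> (forall t, K t -> cabsr (f t%:C) <= r) ->
  calc f x -> cnorm x <= r.
Proof.
move=> r0 fr fx; apply/ler_addgt0Pr => e e0.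
have e2 : 0 < e / 2 by rewrite divr_gt0.
have [p [fp xp]] := fx _ e2.
have : cnorm (horner_alg a p) <= r + e / 2.
  apply: cnorm_horner_alg => // [|t Kt]; first by apply: addr_ge0 => //; exact: ltW.
  have := Re_normD (f t%:C) (p.[t%:C] - f t%:C); rewrite addrC subrK distrC.
  by have := fp _ Kt; have := fr _ Kt; lra.
by have := cnorm_dist x (horner_alg a p); lra.
Qed.

Let calcD f g x y : calc f x -> calc g y -> calc (fun z => f z + g z) (x + y).
Proof.
move=> fx gy e e0; have e2 : 0 < e / 2 by rewrite divr_gt0.
have [p [fp xp]] := fx _ e2; have [q [gq yq]] := gy _ e2.
exists (p + q); split=> [t Kt|].
  rewrite hornerD opprD addrACA; have := Re_normD (f t%:C - p.[t%:C]) (g t%:C - q.[t%:C]).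
  by have := fp _ Kt; have := gq _ Kt; lra.
rewrite rmorphD opprD addrACA; have := cnormD (x - horner_alg a p) (y - horner_alg a q).
by move=> /=; lra.
Qed.

Let calcZ c f x : calc f x -> calc (fun z => c * f z) (c *: x).
Proof.
move=> fx e e0; have c0 : 0 <= cabsr c := Re_norm_ge0 c.
have [|p [fp xp]] := fx (e / (cabsr c + 1)); first by rewrite divr_gt0 //; lra.
have le (s : R) : 0 <= s -> s <= e / (cabsr c + 1) -> cabsr c * s <= e.
  by move=> s0; rewrite ler_pdivlMr; [nra | lra].
exists (c *: p); split=> [t Kt|].
  by rewrite hornerZ -mulrBr Re_normM; apply: le (fp _ Kt); exact: Re_norm_ge0.
rewrite linearZ /= mulr_algl -scalerBr cnormZ; apply: le xp; exact: cnorm_ge0.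
Qed.

Let calc_unique f x y : calc f x -> calc f y -> x = y.
Proof.
move=> fx fy; apply/eqP; rewrite -subr_eq0; apply/eqP/cnorm_le0.
have := calcD fx (calcZ (-1) fy); rewrite scaleN1r; apply: calc_norm => // t _.
by rewrite mulN1r subrr normr0.
Qed.

Let calc_bounded f x : calc f x ->
  exists2 B : R, 0 <= B & forall t, K t -> cabsr (f t%:C) <= B.
Proof.
move=> /(_ 1 ltr01) [p [fp _]]; have [B B0 BP] := poly_bounded p.
exists (1 + B) => [|t Kt]; first by lra.
have := Re_normD (f t%:C - p.[t%:C]) p.[t%:C]; rewrite subrK.
by have := fp _ Kt; have := BP _ Kt; lra.
Qed.

Let calcM f g x y : calc f x -> calc g y -> calc (fun z => f z * g z) (x * y).
Proof.
move=> fx gy e e0.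
have [B B0 BP] := calc_bounded fx; have [C C0 CP] := calc_bounded gy.
have x0 := cnorm_ge0 x; have y0 := cnorm_ge0 y.
pose S := B + C + cnorm x + cnorm y + 1; have S0 : 0 < S by rewrite /S; lra.
pose d := Num.min 1 (e / S).
have d0 : 0 < d by rewrite lt_min ltr01 divr_gt0.
have d1 : d <= 1 by rewrite ge_min lexx.
have dS : d * S <= e by rewrite -ler_pdivlMr // ge_min lexx orbT.
have [p [fp xp]] := fx _ d0; have [q [gq yq]] := gy _ d0.
exists (p * q); split=> [t Kt|].
  rewrite hornerM.
  have -> : f t%:C * g t%:C - p.[t%:C] * q.[t%:C] =
      f t%:C * (g t%:C - q.[t%:C]) + (f t%:C - p.[t%:C]) * q.[t%:C] by ring.
  apply: le_trans (Re_normD _ _) _; rewrite !Re_normM.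
  have h1 := fp _ Kt; have h2 := gq _ Kt; have h3 := BP _ Kt; have h4 := CP _ Kt.
  have := Re_normD (q.[t%:C] - g t%:C) (g t%:C); rewrite subrK distrC => h5.
  apply: le_trans dS.
  have le1 : cabsr (f t%:C) * cabsr (g t%:C - q.[t%:C]) <= B * d.
    by apply: ler_pM => //; exact: Re_norm_ge0.
  have le2 : cabsr (f t%:C - p.[t%:C]) * cabsr q.[t%:C] <= d * (C + 1).
    by apply: ler_pM => //; [exact: Re_norm_ge0 | exact: Re_norm_ge0 | lra].
  by apply: le_trans (lerD le1 le2) _; rewrite /S; nra.
rewrite rmorphM /=; set X := horner_alg a p in xp *; set Y := horner_alg a q in yq *.
have -> : x * y - X * Y = x * (y - Y) + (x - X) * Y by ncring.
have h1 := cnormM x (y - Y); have h2 := cnormM (x - X) Y.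
have h3 := cnormD (x * (y - Y)) ((x - X) * Y).
have := cnorm_dist Y y; rewrite cdistC => h4.
have le1 : cnorm x * cnorm (y - Y) <= cnorm x * d.
  by apply: ler_wpM2l.
have le2 : cnorm (x - X) * cnorm Y <= d * (cnorm y + 1).
  by apply: ler_pM => //; [exact: cnorm_ge0 | exact: cnorm_ge0 | lra].
have : cnorm x * d + d * (cnorm y + 1) <= d * S.
  by rewrite /S; nra.
lra.
Qed.

Let calc_star f x : calc f x -> calc (fun z => (f z)^*%R) (star x).
Proof.
move=> fx e e0; have [p [fp xp]] := fx _ e0.
exists (map_poly Num.conj p); split=> [t Kt|].
  have -> : (map_poly Num.conj p).[t%:C] = ((p.[t%:C])^*)%R.
    by rewrite -{1}(conj_rc t) horner_map.
  by rewrite -rmorphB norm_conjC fp.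
by rewrite -star_horner_alg // -starB cnorm_starE.
Qed.

Let calc_poly p : calc (horner p) (horner_alg a p).
Proof.
move=> e e0; exists p; split=> [t _|]; rewrite subrr ?normr0 ?cnorm0; exact: ltW.
Qed.

Let calc_ext f g x : (forall z, spectrum a z -> f z = g z) -> calc f x -> calc g x.
Proof.
move=> fg fx e /fx [p [fp xp]]; exists p; split=> // t Kt.
by rewrite -fg // fp.
Qed.

Let calc_exists f : cont_spectrum a f -> exists x, calc f x.
Proof.
move=> /approximable_cont fa.
pose d (n : nat) : R := n.+1%:R^-1.
have d0 n : 0 < d n by rewrite invr_gt0.
have dlt (e : R) : 0 < e -> exists N, forall n, (N <= n)%N -> d n < e.
  move=> e0; exists (Num.truncn e^-1) => n Nn.
  rewrite -[ltRHS]invrK ltf_pV2 ?posrE ?invr_gt0 //.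
  by apply: lt_le_trans (truncnS_gt _) _; rewrite ler_nat.
have [p pP] := choice (fun n => fa _ (d0 n)).
have pd m n : cnorm (horner_alg a (p m) - horner_alg a (p n)) <= d m + d n.
  rewrite -rmorphB; apply: cnorm_horner_alg => // [|t Kt].
    by apply: addr_ge0; exact: ltW.
  rewrite hornerD hornerN.
  have := Re_normD ((p m).[t%:C] - f t%:C) (f t%:C - (p n).[t%:C]).
  rewrite addrA subrK [`|_ - f _|]distrC.
  by have := pP m _ Kt; have := pP n _ Kt; lra.
have [|x xP] := @cnorm_complete R A (fun n => horner_alg a (p n)).
  move=> e e0; have e2 : 0 < e / 2 by rewrite divr_gt0.
  have [N NP] := dlt _ e2; exists N => m n Nm Nn.
  by have := NP _ Nm; have := NP _ Nn; have := pd m n; lra.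
exists x => e e0; have [N NP] := dlt _ e0; have [M MP] := xP _ e0.
exists (p (maxn N M)); split=> [t Kt|].
  by apply: le_trans (pP _ _ Kt) (ltW (NP _ _)); rewrite leq_maxl.
by rewrite cdistC ltW // MP // leq_maxr.
Qed.

Lemma functional_calculus_exists : exists Phi, is_functional_calculus a Phi.
Proof.
pose Phi f := xget 0 [set x | calc f x].
have PhiE f x : calc f x -> Phi f = x.
  by move=> fx; apply: (calc_unique _ fx); exact: (xgetPex 0 (ex_intro [set y | calc f y] x fx)).
have PhiP f : cont_spectrum a f -> calc f (Phi f).
  by move=> /calc_exists H; exact: (xgetPex (P := [set y | calc f y]) 0 H).
exists Phi; split.
- move=> f g fc gc fg; apply: PhiE; apply: calc_ext (PhiP _ gc) => z az.
  by rewrite fg.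
- by move=> f g fc gc; apply/PhiE/calcD; exact: PhiP.
- by move=> c f fc; apply/PhiE/calcZ; exact: PhiP.
- by move=> f g fc gc; apply/PhiE/calcM; exact: PhiP.
- by move=> f fc; apply/PhiE/calc_star; exact: PhiP.
- apply: PhiE; have := calc_poly 1; rewrite rmorph1; apply: calc_ext => z _.
  by rewrite hornerC.
- apply: PhiE; have := calc_poly 'X; rewrite horner_algX; apply: calc_ext => z _.
  by rewrite hornerX.
Qed.

End Selfadjoint.
End FunctionalCalculus.

(** * Continuous functions on the real line *)

Section ContinuousReal.
Context {R : realType}.
Local Notation rabs := (@Num.norm R R).
Implicit Types (s t : R) (k l : R -> R).

Lemma continuous_epsP k : continuous k <-> forall s : R, forall e : R, 0 < e ->
  exists2 d : R, 0 < d & forall t, rabs (t - s) < d -> rabs (k t - k s) < e.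
Proof.
split=> [kc s e e0|H s].
  have /cvgrPdist_lt /(_ _ e0) /nbhs_ballP [d d0 dP] := kc s.
  exists d => // t ts; rewrite distrC; apply: dP.
  by rewrite -ball_normE /= distrC.
apply/cvgrPdist_lt => e e0; have [d d0 dP] := H s e e0.
apply/nbhs_ballP; exists d; first exact: d0.
by move=> t ts; rewrite /= distrC; apply: dP; rewrite distrC.
Qed.

Lemma continuous_comp_fun k l : continuous k -> continuous l -> continuous (fun t => l (k t)).
Proof. by move=> kc lc t; exact: (continuous_comp (kc t) (lc (k t))). Qed.

Lemma continuous_sqrt_comp k : continuous k -> continuous (fun t => Num.sqrt (k t)).
Proof. move=> kc; exact (continuous_comp_fun kc (@sqrt_continuous R)). Qed.

Lemma continuousD_fun k l : continuous k -> continuous l -> continuous (fun t => k t + l t).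
Proof. by move=> kc lc t; apply: cvgD; [exact: kc | exact: lc]. Qed.

Lemma continuousM_fun k l : continuous k -> continuous l -> continuous (fun t => k t * l t).
Proof. by move=> kc lc t; apply: cvgM; [exact: kc | exact: lc]. Qed.

Lemma continuous_cst (r : R) : continuous (fun _ : R => r).
Proof. by move=> t; exact: cvg_cst. Qed.

Lemma continuous_idr : continuous (fun t : R => t).
Proof. by move=> t; exact: cvg_id. Qed.

Lemma continuousZ_fun (r : R) k : continuous k -> continuous (fun t => r * k t).
Proof. by apply: continuousM_fun; exact: continuous_cst. Qed.

Lemma continuous_rabs k : continuous k -> continuous (fun t => rabs (k t)).
Proof. by move=> kc t; apply: cvg_norm; exact: kc. Qed.

End ContinuousReal.

Arguments continuous_cst {R} r.
Arguments continuous_idr {R}.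
Arguments continuousZ_fun {R} r [k] _.
Arguments continuousD_fun {R} [k l] _ _.
Arguments continuous_comp_fun {R} [k l] _ _.
Arguments continuousM_fun {R} [k l] _ _.
Arguments continuous_rabs {R} [k] _.
Arguments continuous_sqrt_comp {R} [k] _.

(** * The calculus restricted to real functions *)

Section RealCalculus.
Context {R : realType} {A : cstarAlgType R}.
Local Notation rabs := (@Num.norm R R).
Local Notation cabsr z := (complex.Re `|z|).
Implicit Types (a x y : A) (k l : R -> R) (K : set R).

Definition real_extension k : R[i]^o -> R[i]^o := fun z => (k (complex.Re z))%:C.

Lemma cont_real_extension a k : continuous k -> cont_spectrum a (real_extension k).
Proof.
move=> /continuous_epsP kc; apply/cont_spectrumP => z az e e0.
have [d d0 dP] := kc (complex.Re z) e e0.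
exists d => // w aw wz; rewrite -real_complexB Re_norm_rc; apply: dP.
apply: le_lt_trans wz; rewrite -ler_sqr ?nnegrE ?normr_ge0 ?Re_norm_ge0 //.
by rewrite sqr_Re_norm !raddfB /= real_normK ?num_real // lerDl sqr_ge0.
Qed.

(** What the trace inequalities use of a calculus. Functions are continuous on the whole line, which
    keeps the subspace topology of the spectrum out of sight; only [rcalc_ext] and the bound tie [F]
    to [K]. *)
Record real_calculus (K : set R) (F : (R -> R) -> A) : Prop := {
  rcalc_bounded : exists M : R, forall t, K t -> rabs t <= M ;
  rcalc_ext : forall k l, continuous k -> continuous l ->
    (forall t, K t -> k t = l t) -> F k = F l ;
  rcalcD : forall k l, continuous k -> continuous l ->
    F (fun t => k t + l t) = F k + F l ;
  rcalcZ : forall (r : R) k, continuous k -> F (fun t => r * k t) = r%:C *: F k ;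
  rcalcM : forall k l, continuous k -> continuous l ->
    F (fun t => k t * l t) = F k * F l ;
  rcalc_star : forall k, continuous k -> star (F k) = F k ;
  rcalc1 : F (fun=> 1) = 1
}.

Lemma functional_real_calculus a Phi : star a = a -> is_functional_calculus a Phi ->
  real_calculus [set t | spectrum a t%:C] (fun k => Phi (real_extension k)) /\
  Phi (real_extension id) = a.
Proof.
move=> sa [ext PD PZ PM Ps P1 Pid].
have re z : spectrum a z -> z = (complex.Re z)%:C by exact: spectrum_real.
have id_cont : cont_spectrum a (fun z => z).
  by apply/cont_spectrumP => z _ e e0; exists e.
split; last first.
  rewrite -[RHS]Pid; apply: (ext _ _ (@cont_real_extension a _ continuous_idr) id_cont).
  by move=> z /re {2}->.
split.
- by exists (cnorm a) => t /spectrum_bound; rewrite Re_norm_rc.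
- move=> k l kc lc kl; apply: ext; try exact: cont_real_extension.
  by move=> z az; rewrite /real_extension kl //= -re.
- move=> k l kc lc; rewrite -PD; try exact: cont_real_extension.
  by congr Phi; apply/funext => z; rewrite /real_extension real_complexD.
- move=> r k kc; rewrite -PZ; try exact: cont_real_extension.
  by congr Phi; apply/funext => z; rewrite /real_extension real_complexM.
- move=> k l kc lc; rewrite -PM; try exact: cont_real_extension.
  by congr Phi; apply/funext => z; rewrite /real_extension real_complexM.
- move=> k kc; rewrite -Ps; try exact: cont_real_extension.
  by congr Phi; apply/funext => z; rewrite /real_extension conj_rc.
- by rewrite -P1.
Qed.

Lemma selfadjoint_real_calculus a : star a = a -> exists F,
  real_calculus [set t | spectrum a t%:C] F /\ F id = a.
Proof.
move=> sa; have [Phi PhiP] := functional_calculus_exists sa.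
exists (fun k => Phi (real_extension k)); exact: functional_real_calculus.
Qed.

Lemma continuous_sum n (k : nat -> R -> R) : (forall i, continuous (k i)) ->
  continuous (fun t => \sum_(i < n) k i t).
Proof.
move=> kc; elim: n => [|n IH].
  rewrite (_ : (fun _ => _) = fun=> 0); first exact: continuous_cst.
  by apply/funext => t; rewrite big_ord0.
rewrite (_ : (fun _ => _) = fun t => (\sum_(i < n) k i t) + k n t).
  exact: continuousD_fun.
by apply/funext => t; rewrite big_ord_recr.
Qed.

Lemma continuous_ramp (al be : R) : continuous (fun t => ramp (al * t + be)).
Proof.
have ab g : continuous (fun t => rabs (al * t + g)).
  exact: continuous_rabs (continuousD_fun (continuousZ_fun al continuous_idr) (continuous_cst g)).
rewrite (_ : (fun t => _) = fun t =>
  2^-1 * (rabs (al * t + be) + (-1) * rabs (al * t + (be - 1)) + 1)); last first.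
  by apply/funext => t; rewrite /ramp mulN1r addrA.
exact: continuousZ_fun (continuousD_fun (continuousD_fun (ab be)
  (continuousZ_fun (-1) (ab (be - 1)))) (continuous_cst 1)).
Qed.

Lemma continuous_hat (d b i : R) : continuous (hat d b i).
Proof.
rewrite (_ : hat d b i = fun t =>
  ramp (d^-1 * t + (b - i + 1)) + (-1) * ramp (d^-1 * t + (b - i))); last first.
  by apply/funext => t; rewrite mulN1r /hat [t / d]mulrC.
exact (continuousD_fun (@continuous_ramp d^-1 _)
  (continuousZ_fun (-1) (@continuous_ramp d^-1 _))).
Qed.

Section Calculus.
Variables (K : set R) (F : (R -> R) -> A) (FP : real_calculus K F).

Lemma rcalc0 : F (fun=> 0) = 0.
Proof.
have := rcalcZ FP 0 (continuous_cst 1); rewrite scale0r => <-.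
by congr F; apply/funext => t; rewrite mul0r.
Qed.

Lemma rcalc_cst (r : R) : F (fun=> r) = r%:C%:A.
Proof.
rewrite -(rcalc1 FP) -(rcalcZ FP); last exact: continuous_cst.
by congr F; apply/funext => t; rewrite mulr1.
Qed.

Lemma rcalcN k : continuous k -> F (fun t => - k t) = - F k.
Proof.
move=> kc; have := rcalcZ FP (-1) kc; rewrite real_complexN scaleNr scale1r => <-.
by congr F; apply/funext => t; rewrite mulN1r.
Qed.

Lemma rcalcB k l : continuous k -> continuous l -> F (fun t => k t - l t) = F k - F l.
Proof.
move=> kc lc; rewrite -(rcalcN lc) -(rcalcD FP) //.
by move=> t; apply: cvgN; exact: lc.
Qed.

Lemma rcalc_sum n (k : nat -> R -> R) : (forall i, continuous (k i)) ->
  F (fun t => \sum_(i < n) k i t) = \sum_(i < n) F (k i).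
Proof.
move=> kc; elim: n => [|n IH].
  rewrite big_ord0 -rcalc0; congr F; apply/funext => t; exact: big_ord0.
rewrite big_ord_recr /= -IH -(rcalcD FP) //; last exact: continuous_sum.
by congr F; apply/funext => t; rewrite big_ord_recr.
Qed.

Lemma rcalc_ge0 k : continuous k -> (forall t, K t -> 0 <= k t) ->
  exists2 w : A, star w = w & F k = w * w.
Proof.
move=> kc k0; have sc := continuous_sqrt_comp kc.
exists (F (fun t => Num.sqrt (k t))); first exact: (rcalc_star FP).
rewrite -(rcalcM FP) //; apply: (rcalc_ext FP) => //; first exact: continuousM_fun.
by move=> t Kt; rewrite -expr2 sqr_sqrtr // k0.
Qed.

(** [K] is not assumed to be a spectrum, so the bound comes from (F k)^2 + (F l)^2 = 1 with l = sqrt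
    (1 - k^2). *)
Lemma rcalc_contractive k : continuous k -> (forall t, K t -> rabs (k t) <= 1) ->
  cnorm (F k) <= 1.
Proof.
move=> kc k1; pose l t := Num.sqrt (1 - k t * k t).
have lc : continuous l.
  apply: continuous_sqrt_comp; under [X in continuous X]eq_fun do rewrite -mulN1r.
  apply: continuousD_fun (continuous_cst _) _; apply: continuousZ_fun; exact: continuousM_fun.
rewrite -(ler_sqr (cnorm_ge0 _) ler01) expr1n.
have := @norm_le_of_sum_sqr R A (F k) (F l) 1.
rewrite normr1; apply; rewrite ?(rcalc_star FP) //.
  by rewrite -!(rcalcM FP) //; congr F; apply/funext => t; rewrite mulrC.
rewrite !expr2 -!(rcalcM FP) // -(rcalcD FP) //; try exact: continuousM_fun.
rewrite -rcalc_cst; apply: (rcalc_ext FP) => //.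
- by apply: continuousD_fun; exact: continuousM_fun.
- exact: continuous_cst.
move=> t Kt; rewrite /l -[X in _ + X]expr2 sqr_sqrtr ?subrKC //.
rewrite subr_ge0 -expr2 -real_normK ?num_real //.
by rewrite expr_le1 // k1.
Qed.

End Calculus.
End RealCalculus.

(** * Faithful traces *)

Section Trace.
Context {R : realType} {A : cstarAlgType R} (tau : {scalar A}).
Hypotheses (tau_state : state tau) (tau_tracial : tracial tau).
Local Notation rabs := (@Num.norm R R).
Implicit Types (x y u w h : A) (k l : R -> R) (K : set R).

(** The real part keeps all inequalities in [R]; by [tau_real] nothing is lost on selfadjoint
    elements. *)
Definition retr x : R := complex.Re (tau x).

Lemma retrD x y : retr (x + y) = retr x + retr y.
Proof. by rewrite /retr raddfD raddfD. Qed.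

Lemma retrN x : retr (- x) = - retr x.
Proof. by rewrite /retr raddfN raddfN. Qed.

Lemma retrB x y : retr (x - y) = retr x - retr y.
Proof. by rewrite retrD retrN. Qed.

Lemma retrZ (r : R) x : retr (r%:C *: x) = r * retr x.
Proof. by rewrite /retr linearZ /=; case: (tau x) => s t /=; rewrite mul0r subr0. Qed.

Lemma retr0 : retr 0 = 0.
Proof. by rewrite /retr raddf0. Qed.

Lemma retr_sum n (x : 'I_n -> A) : retr (\sum_(i < n) x i) = \sum_(i < n) retr (x i).
Proof. by apply: (big_morph retr retrD retr0). Qed.

Lemma retrC x y : retr (x * y) = retr (y * x).
Proof. by rewrite /retr tau_tracial. Qed.

Lemma retr1 : retr 1 = 1.
Proof. by rewrite /retr; have [_ ->] := tau_state. Qed.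

Lemma retr_sqr_ge0 w : star w = w -> 0 <= retr (w * w).
Proof.
move=> sw; have [+ _] := tau_state; move=> /(_ _ (positive_sqr sw)).
by rewrite expr2 lecE => /andP[].
Qed.

(** 2 h = (h + 1)^2 - h^2 - 1, and the squares of selfadjoint elements have nonnegative, hence real,
    values. *)
Lemma tau_real h : star h = h -> tau h = (retr h)%:C.
Proof.
move=> sh; have [pos t1] := tau_state.
have im0 w : star w = w -> complex.Im (tau (w ^+ 2)) = 0.
  by move=> sw; have := pos _ (positive_sqr sw); rewrite lecE => /andP[/eqP].
have := im0 (h + 1); rewrite starD sh star1 => /(_ erefl).
rewrite (_ : (h + 1) ^+ 2 = h ^+ 2 + (h + h) + 1); last by ncring.
rewrite !raddfD /= im0 // t1 /= add0r addr0 => i0.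
rewrite [LHS]complexE /retr (_ : complex.Im (tau h) = 0) ?mulr0 ?addr0 //.
by move: i0; lra.
Qed.

Let imult (x : A) : A := 'i%C *: x.

Let im_star : (('i%C : R[i])^*)%R = - 'i%C.
Proof. by apply/eqP; rewrite eq_complex /= oppr0 !eqxx. Qed.

(** i (x - star x) is selfadjoint, so its trace is real and that of x - star x is purely
    imaginary. *)
Lemma retr_star x : retr (star x) = retr x.
Proof.
apply/eqP; rewrite eq_sym -subr_eq0 -retrB; apply/eqP.
have /tau_real : star (imult (x - star x)) = imult (x - star x).
  by rewrite /imult starZ im_star starB starK scaleNr -scalerN opprB.
rewrite /imult linearZ /= /retr linearZ /=; case: (tau _) => s t /= /eqP.
by rewrite eq_complex /= !mul0r !mul1r !add0r => /andP[_ /eqP].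
Qed.

(* [y + star y] and [i (star y - y)] are selfadjoint, and their squares add up to
   [2 (star y * y + y * star y)], whose trace is [4 tau (star y * y)]. *)
Lemma retr_star_mul_ge0 y : 0 <= retr (star y * y).
Proof.
have h1 := @retr_sqr_ge0 (y + star y); have h2 := @retr_sqr_ge0 (imult (star y - y)).
have := h1 _; rewrite starD starK addrC => /(_ erefl) {}h1.
have {}h2 : 0 <= retr (imult (star y - y) * imult (star y - y)).
  by apply: h2; rewrite /imult starZ im_star starB starK scaleNr -scalerN opprB.
have e : imult (star y - y) * imult (star y - y) = - ((star y - y) * (star y - y)).
  by rewrite /imult -scalerAl -scalerAr scalerA -expr2 sqr_i scaleN1r.
have := addr_ge0 h1 h2; rewrite e -retrD.
rewrite (_ : _ + - _ = (star y * y + y * star y) + (star y * y + y * star y)); last by ncring.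
by rewrite !retrD [retr (y * star y)]retrC; lra.
Qed.

Lemma retr_mul_star_ge0 y : 0 <= retr (y * star y).
Proof. by rewrite retrC retr_star_mul_ge0. Qed.

Lemma retr_mul_le x y :
  2 * retr (x * star y) <= retr (x * star x) + retr (y * star y).
Proof.
have := retr_mul_star_ge0 (x - y).
rewrite starB (_ : (x - y) * (star x - star y) =
  x * star x + y * star y - x * star y - y * star x); last by ncring.
by rewrite !retrB retrD -[retr (y * star x)]retr_star starM starK; lra.
Qed.

Hypothesis tau_faithful : faithful tau.

Lemma retr_sqr_eq0 w : star w = w -> retr (w * w) <= 0 -> w = 0.
Proof.
move=> sw w0; have w2 : w ^+ 2 = 0.
  apply: tau_faithful; first exact: positive_sqr.
  rewrite tau_real ?starX ?sw // (_ : retr _ = 0) //.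
  by apply/eqP; rewrite eq_le expr2 w0 retr_sqr_ge0.
apply: cnorm0_eq0; apply/eqP; rewrite -sqrf_eq0 -cnorm_sqr_sa // w2.
by rewrite cnorm0.
Qed.

(* With [n] the negative part of [c = star x * x] and [y = x * n(c)], the positivity
   of [tau (star y * y) = - tau (n(c) ^ 3)] forces [n(c) = 0]. *)
Lemma positive_star_mul x : positive (star x * x).
Proof.
set c := star x * x; have sc : star c = c by rewrite /c starM starK.
have [F [FP Fid]] := selfadjoint_real_calculus sc.
set K := [set t | _]%classic in FP.
pose n (t : R) : R := 2^-1 * (rabs t + (-1) * t).
pose p (t : R) : R := 2^-1 * (rabs t + t).
have nc : continuous n.
  exact (continuousZ_fun 2^-1 (continuousD_fun (continuous_rabs continuous_idr)
    (continuousZ_fun (-1) continuous_idr))).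
have pc : continuous p.
  exact (continuousZ_fun 2^-1 (continuousD_fun (continuous_rabs continuous_idr) continuous_idr)).
have n0 t : 0 <= n t by rewrite /n; case: (ger0P t) => ?; lra.
have p0 t : 0 <= p t by rewrite /p; case: (ger0P t) => ?; lra.
have nn := continuousM_fun nc nc; have nnn := continuousM_fun nn nc.
have [v sv vE] : exists2 v : A, star v = v & F (fun t => n t * n t * n t) = v * v.
  by apply: (rcalc_ge0 FP nnn) => t _; exact: mulr_ge0 (mulr_ge0 (n0 t) (n0 t)) (n0 t).
have v0 : v = 0.
  apply: retr_sqr_eq0 => //.
  have := retr_star_mul_ge0 (x * F n).
  rewrite starM (rcalc_star FP) // -mulrA (mulrA (star x)) -/c -{1}Fid.
  rewrite -!(rcalcM FP) //; try (by do ?apply: continuousM_fun => //; exact: continuous_idr).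
  rewrite (_ : (fun t => _) = fun t => - (n t * n t * n t)); last first.
    by apply/funext => t; rewrite /n; case: (ger0P t) => ?; field.
  by rewrite (rcalcN FP) // vE retrN oppr_ge0.
have Fn0 : F n = 0.
  have sFn := rcalc_star FP nc.
  have F20 : (F n ^+ 2) ^+ 2 = 0.
    have F30 : F n * F n * F n = 0.
      by rewrite -(rcalcM FP nc nc) -(rcalcM FP nn nc) vE v0 mul0r.
    by rewrite !expr2 mulrA F30 mul0r.
  have sq0 w : star w = w -> w ^+ 2 = 0 -> w = 0.
    move=> sw w2; apply: cnorm0_eq0; apply/eqP.
    by rewrite -sqrf_eq0 -cnorm_sqr_sa // w2 cnorm0.
  by apply: (sq0 _ sFn); apply: sq0 F20; rewrite starX sFn.
have -> : c = F p.
  rewrite -Fid -[RHS]subr0 -Fn0 -(rcalcB FP) //; congr F.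
  by apply/funext => t; rewrite /p /n; lra.
have [w sw ->] := rcalc_ge0 FP pc (fun t _ => p0 t).
by rewrite -expr2; exact: positive_sqr.
Qed.

End Trace.

(** * Positivity of the bilinear trace functional *)

Section Positivity.
Context {R : realType} {A : cstarAlgType R} (tau : {scalar A}).
Hypotheses (tau_state : state tau) (tau_tracial : tracial tau).
Local Notation rabs := (@Num.norm R R).
Local Notation retr := (retr tau).
Implicit Types (x y u w h : A) (k l : R -> R) (K L : set R) (F G : (R -> R) -> A).

(** A product of two positive elements need not be positive, but traciality carries one [w] around
    to form [star (y * w) * (y * w)]. *)
Lemma retr_sandwich_ge0 w y : star w = w -> 0 <= retr (w * w * (star y * y)).
Proof.
move=> sw; rewrite -mulrA (retrC tau_tracial) -mulrA.
rewrite (_ : w * (star y * y * w) = star (y * w) * (y * w)); last first.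
  by rewrite starM sw !mulrA.
exact: retr_star_mul_ge0.
Qed.

Lemma retr_rcalc_le K F k (e : R) y : real_calculus K F -> continuous k ->
  (forall t, K t -> rabs (k t) <= e) ->
  rabs (retr (F k * (star y * y))) <= e * retr (star y * y).
Proof.
move=> FP kc ke.
suff le l : continuous l -> (forall t, K t -> l t <= e) ->
    retr (F l * (star y * y)) <= e * retr (star y * y).
  rewrite ler_norml; apply/andP; split.
    have kcN := continuousZ_fun (-1) kc.
    have := le _ kcN; rewrite (rcalcZ FP) // real_complexN scaleNr scale1r mulNr (retrN tau).
    rewrite lerNl; apply=> t Kt; rewrite mulN1r lerNl.
    by have := ke _ Kt; rewrite ler_norml => /andP[].
  by apply: le => // t /ke; rewrite ler_norml => /andP[].
move=> lc le; have lc' := continuousD_fun (continuous_cst e) (continuousZ_fun (-1) lc).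
have [|w sw wE] := rcalc_ge0 FP lc'; first by move=> t /le; rewrite mulN1r subr_ge0.
have := retr_sandwich_ge0 y sw; rewrite -wE (rcalcD FP); first last.
- exact: continuousZ_fun.
- exact: continuous_cst.
rewrite (rcalcZ FP) // (rcalc_cst FP) real_complexN scaleNr scale1r mulrBl mulr_algl.
by rewrite (retrB tau) (retrZ tau) subr_ge0.
Qed.

(* The values of the [f k] are replaced by finite combinations of the hat functions
   of a fine partition of unity, with error at most [e]. *)
Lemma retr_rcalc_sum_ge0 K F n (f : nat -> R -> R) (B P Q : nat -> A) :
  real_calculus K F -> (forall i, continuous (f i)) ->
  (forall i, B i = star (P i) * P i - star (Q i) * Q i) ->
  (forall s, K s -> exists y, \sum_(i < n) (f i s)%:C *: B i = star y * y) ->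
  0 <= \sum_(i < n) retr (F (f i) * B i).
Proof.
move=> FP fc BE H.
(* As [B i] is a difference of two positive elements, a function bounded by e on [K] changes the
   i-th term by at most e [N i]. *)
pose N i := retr (star (P i) * P i) + retr (star (Q i) * Q i).
have N0 i : 0 <= N i by rewrite addr_ge0 // retr_star_mul_ge0.
pose C := \sum_(i < n) N i.
have C0 : 0 <= C by apply: sumr_ge0.
apply/ler_addgt0Pr => e' e'0; pose e := e' / (C + 1).
have e0 : 0 < e by rewrite divr_gt0 //; lra.
have eC : e * C <= e'.
  have : e * (C + 1) = e' by rewrite divfK // gt_eqF //; lra.
  by rewrite mulrDr mulr1; lra.
apply: (@le_trans _ _ (\sum_(i < n) retr (F (f i) * B i) + e * C)); last by rewrite lerD2l.
have [M KM] := rcalc_bounded FP.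
pose D s t := \sum_(i < n) rabs (f i s - f i t).
(* Uniform continuity is taken on the interval [-M, M], which is closed, whereas [K] is only known
   to be bounded. *)
have [||||d d0 dP] := @uniform_on_compact R [set t | rabs t <= M]%classic D M _ _ _ _ e e0.
- by [].
- move=> l ll /=; apply/ler_addgt0Pr => r /ll [t /= tM tl].
  have := ler_normB t (t - l); rewrite opprB addrC subrK.
  by move: tM tl; lra.
- move=> r s t; rewrite /D -big_split /=; apply: ler_sum => i _.
  rewrite (distrC (f i r)); have := ler_normD (f i s - f i r) (f i r - f i t).
  by rewrite addrA subrK.
- move=> l _ r r0.
  have Dc : continuous (D l).
    apply: (continuous_sum (k := fun i t => rabs (f i l - f i t))) => i.
    apply: continuous_rabs; under [X in continuous X]eq_fun do rewrite -mulN1r.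
    exact (continuousD_fun (continuous_cst _) (continuousZ_fun _ (fc i))).
  have [d d0 dP] := (continuous_epsP (D l)).1 Dc l r r0.
  exists d => // t _ /dP; rewrite (_ : D l l = 0) ?subr0; last first.
    by rewrite /D big1 // => i _; rewrite subrr normr0.
  by apply: le_lt_trans; exact: ler_norm.
have d2 : 0 < d / 2 by rewrite divr_gt0.
have [m [b [s [h0 h1 hs]]]] := partition_of_unity KM d2.
pose hh j := hat (d / 2) b j%:R.
have hc (j : nat) : continuous (hh j) by exact: continuous_hat.
pose g i t := \sum_(j < m) f i (s j) * hh j t.
have gc i : continuous (g i).
  by apply: (continuous_sum (k := fun j t => f i (s j) * hh j t)) => j; exact: continuousZ_fun.
have fg (i : 'I_n) t : K t -> rabs (f i t - g i t) <= e.
  move=> Kt.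
  have -> : f i t - g i t = \sum_(j < m) (f i t - f i (s j)) * hh j t.
    under eq_bigr => j _ do rewrite mulrBl.
    by rewrite sumrB -mulr_sumr h1 // mulr1.
  apply: (@le_trans _ _ (\sum_(j < m) e * hh j t)); last by rewrite -mulr_sumr h1 // mulr1.
  apply: le_trans (ler_norm_sum _ _ _) _; apply: ler_sum => j _.
  rewrite normrM (ger0_norm (h0 _ _)) -/(hh j t).
  have [->|/(hs j _ Kt) [Ks st]] := eqVneq (hh j t) 0; first by rewrite !mulr0.
  rewrite ler_wpM2r ?h0 //; apply: le_trans (ltW (dP t (s j) (KM _ Kt) (KM _ Ks) _)); last lra.
  by rewrite /D (bigD1 i) //= lerDl sumr_ge0.
have Fg : 0 <= \sum_(i < n) retr (F (g i) * B i).
  have -> : \sum_(i < n) retr (F (g i) * B i) =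
      \sum_(j < m) retr (F (hh j) * \sum_(i < n) (f i (s j))%:C *: B i).
    under eq_bigr => i _.
      rewrite (@rcalc_sum _ _ _ _ FP _ (fun j t => f i (s j) * hh j t)); last first.
        by move=> j; exact: continuousZ_fun.
      rewrite mulr_suml (retr_sum tau).
      under eq_bigr => j _ do rewrite (rcalcZ FP) // -scalerAl (retrZ tau).
      over.
    rewrite exchange_big; apply: eq_bigr => j _.
    rewrite mulr_sumr (retr_sum tau); apply: eq_bigr => i _.
    by rewrite -scalerAr (retrZ tau).
  apply: sumr_ge0 => j _.
  have [Ks|nKs] := pselect (K (s j)).
    have [y ->] := H _ Ks.
    have [w sw ->] := rcalc_ge0 FP (hc j) (fun t _ => h0 _ _).
    exact: retr_sandwich_ge0.
  rewrite (_ : F (hh j) = 0) ?mul0r /retr ?raddf0 //.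
  rewrite -(rcalc0 FP); apply: (rcalc_ext FP) => //; first exact: continuous_cst.
  by move=> t Kt; apply/eqP/negPn/negP => /(hs j _ Kt) [].
apply: le_trans Fg _; rewrite /C mulr_sumr -big_split /=; apply: ler_sum => i _.
rewrite -lerBlDl -(retrB tau) -mulrBl -(rcalcB FP) //.
rewrite BE mulrBr (retrB tau).
have gfc : continuous (fun t => g i t - f i t).
  under [X in continuous X]eq_fun do rewrite -mulN1r.
  exact (continuousD_fun (gc i) (continuousZ_fun _ (fc i))).
have gf t : K t -> rabs (g i t - f i t) <= e by move=> Kt; rewrite distrC fg.
have := retr_rcalc_le (P i) FP gfc gf; have := retr_rcalc_le (Q i) FP gfc gf.
by rewrite !ler_norml /N mulrDr => /andP[? ?] /andP[? ?]; lra.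
Qed.

(** For fixed s in [K], the calculus [G] turns the function of t, nonnegative on [L], into a square
    w^2, so the terms combine to [star (w * u) * (w * u)]; [retr_rcalc_sum_ge0] then handles s. The
    parts of [g i] of either sign provide [P] and [Q]. *)
Lemma retr_bilinear_ge0 K L F G n (f g : nat -> R -> R) u :
  real_calculus K F -> real_calculus L G ->
  (forall i, continuous (f i)) -> (forall i, continuous (g i)) ->
  (forall s t, K s -> L t -> 0 <= \sum_(i < n) f i s * g i t) ->
  0 <= \sum_(i < n) retr (F (f i) * (star u * G (g i) * u)).
Proof.
move=> FP GP fc gc fg.
have pq i : exists PQ : A * A, star u * G (g i) * u =
    star PQ.1 * PQ.1 - star PQ.2 * PQ.2.
  pose gp t : R := 2^-1 * (rabs (g i t) + g i t).
  pose gn t : R := 2^-1 * (rabs (g i t) + (-1) * g i t).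
  have gpc : continuous gp.
    exact (continuousZ_fun _ (continuousD_fun (continuous_rabs (gc i)) (gc i))).
  have gnc : continuous gn.
    exact (continuousZ_fun _ (continuousD_fun (continuous_rabs (gc i))
      (continuousZ_fun _ (gc i)))).
  have [|w sw wE] := rcalc_ge0 GP gpc.
    by move=> t _; rewrite /gp; case: (ger0P (g i t)) => ?; lra.
  have [|v sv vE] := rcalc_ge0 GP gnc.
    by move=> t _; rewrite /gn; case: (ger0P (g i t)) => ?; lra.
  exists (w * u, v * u); rewrite /= !starM sw sv.
  have -> : G (g i) = w * w - v * v.
    rewrite -wE -vE -(rcalcB GP) //; congr G.
    by apply/funext => t; rewrite /gp /gn; lra.
  by ncring.
have [PQ PQP] := choice pq.
apply: (retr_rcalc_sum_ge0 (P := fun i => (PQ i).1) (Q := fun i => (PQ i).2) FP fc PQP).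
move=> s Ks.
have gsc : continuous (fun t => \sum_(i < n) f i s * g i t).
  by apply: (continuous_sum (k := fun i t => f i s * g i t)) => i; exact: continuousZ_fun.
have [|w sw wE] := rcalc_ge0 GP gsc; first by move=> t; exact: fg.
exists (w * u); rewrite starM sw -mulrA (mulrA w) -wE.
rewrite (@rcalc_sum _ _ _ _ GP _ (fun i t => f i s * g i t)); last first.
  by move=> i; exact: continuousZ_fun.
rewrite mulr_suml mulr_sumr; apply: eq_bigr => i _.
by rewrite (rcalcZ GP) // -scalerAl -scalerAr mulrA.
Qed.

End Positivity.

(** * Scalar inequalities *)

Section Powers.
Context {R : realType}.
Local Notation rabs := (@Num.norm R R).
Implicit Types (s t : R) (k : R -> R).

Lemma continuous_bounded k (M : R) : continuous k ->
  exists N : R, forall t, rabs t <= M -> rabs (k t) <= N.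
Proof.
move=> kc; have [M0|M0] := leP 0 M; last first.
  by exists 0 => t tM; have := normr_ge0 t; have := le_lt_trans tM M0; rewrite ltNge => /negP.
have MM : - M <= M by lra.
have kc' : {within `[- M, M], continuous (fun t => rabs (k t))}.
  by apply: continuous_subspaceT; exact: continuous_rabs.
have [c _ cP] := EVT_max MM kc'.
exists (rabs (k c)) => t; rewrite ler_norml => tM; apply: cP.
by rewrite in_itv.
Qed.

(* [`^] jumps to the junk value 1 at negative bases; [pw r] is continuous on the line. *)
Definition pw (r t : R) : R := rabs t `^ r.

Lemma pwE r t : 0 <= t -> pw r t = t `^ r.
Proof. by move=> t0; rewrite /pw ger0_norm. Qed.

Lemma pw_ge0 r t : 0 <= pw r t.
Proof. exact: powR_ge0. Qed.

Lemma continuous_pw r : 0 < r -> continuous (pw r).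
Proof.
move=> r0 t; have [->|t0] := eqVneq t 0.
  apply/cvgrPdist_lt => e e0; rewrite /pw normr0 powR0 ?gt_eqF //.
  have d0 : 0 < e `^ r^-1 by rewrite powR_gt0.
  apply/nbhs_ballP; exists (e `^ r^-1); first exact: d0.
  move=> s sd /=; have {sd} : rabs (0 - s) < e `^ r^-1 by exact: sd.
  rewrite sub0r normrN => sd; rewrite sub0r normrN ger0_norm ?powR_ge0 //.
  have -> : e = (e `^ r^-1) `^ r by rewrite -powRrM mulVf ?gt_eqF // powRr1 // ltW.
  by rewrite gt0_ltr_powR // nnegrE ?normr_ge0 // ltW.
have at0 : 0 < rabs t by rewrite normr_gt0.
rewrite /pw; apply: (@cvg_comp _ _ _ (fun s : R => `|s|) (fun s : R => s `^ r) _ (nbhs (rabs t))).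
  by apply: cvg_norm; exact: cvg_id.
have /differentiable_continuous : differentiable (fun s : R => s `^ r) (rabs t).
  by apply/derivable1_diffP; apply: derivable_powR; rewrite in_itv /= at0.
exact.
Qed.

(* With [x = S^2] and [y = T^2], moving [al (S - T)^2] to the right leaves the
   weighted inequality between [T^2] and [S T] with weights [be - al] and [2 al]. *)
Lemma young_refined_aux (S T al be : R) : 0 <= S -> 0 <= T -> 0 < al -> al <= be ->
  al + be = 1 ->
  al * (S - T) ^+ 2 + S `^ (2 * al) * T `^ (2 * be) <= al * S ^+ 2 + be * T ^+ 2.
Proof.
move=> S0 T0 al0 alb ab1.
suff : S `^ (2 * al) * T `^ (2 * be) <= (be - al) * T ^+ 2 + (2 * al) * (S * T) by nra.
have ST0 : 0 <= S * T by exact: mulr_ge0.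
(* If al = be, the weight be - al vanishes and has no conjugate exponent; both sides are then S
   T. *)
have [e|ne] := eqVneq al be.
  have -> : 2 * al = 1 by lra.
  have -> : 2 * be = 1 by lra.
  by rewrite !powRr1 // e subrr mul0r add0r mul1r.
have ba : 0 < be - al by rewrite subr_gt0 lt_neqAle ne.
have al2 : 0 < 2 * al by lra.
(* The weights be - al and 2 al add up to al + be = 1. *)
have := @conjugate_powR R (T `^ (2 * (be - al))) ((S * T) `^ (2 * al))
  (be - al)^-1 (2 * al)^-1 (powR_ge0 _ _) (powR_ge0 _ _).
rewrite !invr_gt0 !invrK => /(_ ba al2) H.
have {H} := H _; rewrite -!powRrM mulfV ?gt_eqF // powRr1 // mulfK ?gt_eqF //.
rewrite powR_mulrn // powRM // => H.
have -> : S `^ (2 * al) * T `^ (2 * be) =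
    T `^ (2 * (be - al)) * (S `^ (2 * al) * T `^ (2 * al)).
  rewrite mulrCA -powRD; first by congr (_ * _ `^ _); ring.
  by apply/implyP => /eqP; lra.
by rewrite [(be - al) * _]mulrC [2 * al * _]mulrC; apply: H; lra.
Qed.

Lemma young_refined (p q s t : R) : 0 < p -> 0 < q -> p^-1 + q^-1 = 1 ->
  0 <= s -> 0 <= t ->
  Num.min p^-1 q^-1 * (pw (p / 2) s - pw (q / 2) t) ^+ 2 + s * t <=
  p^-1 * pw p s + q^-1 * pw q t.
Proof.
move=> p0 q0 pq s0 t0; rewrite !pwE //.
have half (r x : R) : 0 < r -> 0 <= x ->
    (x `^ (r / 2)) ^+ 2 = x `^ r /\ (x `^ (r / 2)) `^ (2 * r^-1) = x.
  move=> r0 x0; split.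
    rewrite expr2 -powRD; first by congr (_ `^ _); field.
    by apply/implyP => /eqP; lra.
  rewrite -powRrM (_ : r / 2 * (2 * r^-1) = 1) ?powRr1 //.
  by field; rewrite gt_eqF.
have [eS S'] := half p s p0 s0; have [eT T'] := half q t q0 t0.
have st : s * t = (s `^ (p / 2)) `^ (2 * p^-1) * (t `^ (q / 2)) `^ (2 * q^-1).
  by rewrite S' T'.
rewrite -eS -eT st.
set S := s `^ (p / 2); set T := t `^ (q / 2).
have S0 : 0 <= S := powR_ge0 _ _; have T0 : 0 <= T := powR_ge0 _ _.
have p1 : 0 < p^-1 by rewrite invr_gt0.
have q1 : 0 < q^-1 by rewrite invr_gt0.
have [le|lt] := leP p^-1 q^-1; first exact: young_refined_aux.
rewrite -(sqrrN (S - T)) opprB (mulrC (S `^ _)) [leRHS]addrC.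
by apply: young_refined_aux => //; [exact: ltW | rewrite addrC].
Qed.

End Powers.

(** * Uniqueness of the calculus and composition *)

Section Young.
Context {R : realType} {A : cstarAlgType R} (tau : {scalar A}).
Hypotheses (tau_state : state tau) (tau_tracial : tracial tau).
Hypothesis tau_faithful : faithful tau.
Local Notation rabs := (@Num.norm R R).
Local Notation retr := (retr tau).
Implicit Types (a b x y u w h : A) (f g k l : R -> R) (K L : set R) (F G : (R -> R) -> A).

(** Four products are enough: a term in s alone, a term in t alone, and two mixed ones. *)
Lemma retr_bilinear4_ge0 K L F G f0 f1 f2 f3 g0 g1 g2 g3 u :
  real_calculus K F -> real_calculus L G ->
  [/\ continuous f0, continuous f1, continuous f2 & continuous f3] ->
  [/\ continuous g0, continuous g1, continuous g2 & continuous g3] ->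
  (forall s t, K s -> L t ->
     0 <= f0 s * g0 t + f1 s * g1 t + f2 s * g2 t + f3 s * g3 t) ->
  0 <= retr (F f0 * (star u * G g0 * u)) + retr (F f1 * (star u * G g1 * u)) +
       retr (F f2 * (star u * G g2 * u)) + retr (F f3 * (star u * G g3 * u)).
Proof.
move=> FP GP [fc0 fc1 fc2 fc3] [gc0 gc1 gc2 gc3] fg.
pose sel (h0 h1 h2 h3 : R -> R) (i : nat) :=
  match i with 0%N => h0 | 1%N => h1 | 2%N => h2 | _ => h3 end.
have := @retr_bilinear_ge0 R A tau tau_state tau_tracial K L F G 4
  (sel f0 f1 f2 f3) (sel g0 g1 g2 g3) u FP GP.
rewrite !big_ord_recl big_ord0 /= addr0 !addrA; apply.
- by do 4 case=> //.
- by do 4 case=> //.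
- by move=> s t Ks Lt; rewrite !big_ord_recl big_ord0 /= addr0 !addrA; exact: fg.
Qed.

Lemma retr_bilinear4_1_ge0 K L F G f0 f1 f2 f3 g0 g1 g2 g3 :
  real_calculus K F -> real_calculus L G ->
  [/\ continuous f0, continuous f1, continuous f2 & continuous f3] ->
  [/\ continuous g0, continuous g1, continuous g2 & continuous g3] ->
  (forall s t, K s -> L t ->
     0 <= f0 s * g0 t + f1 s * g1 t + f2 s * g2 t + f3 s * g3 t) ->
  0 <= retr (F f0 * G g0) + retr (F f1 * G g1) + retr (F f2 * G g2) + retr (F f3 * G g3).
Proof.
move=> FP GP fc gc /(retr_bilinear4_ge0 1 FP GP fc gc).
by rewrite star1 !mul1r !mulr1.
Qed.

Lemma retr_sqrB x y : retr ((x - y) * (x - y)) =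
  retr (x * x) - 2 * retr (x * y) + retr (y * y).
Proof.
rewrite (_ : _ * _ = x * x - x * y - y * x + y * y); last by ncring.
by rewrite !(retrD tau) !(retrN tau) [retr (y * x)](retrC tau_tracial); ring.
Qed.

Lemma bounded_fun_calculus K F f : real_calculus K F -> continuous f ->
  exists N : R, forall t, K t -> rabs (f t) <= N.
Proof.
move=> FP fc; have [M KM] := rcalc_bounded FP.
by have [N NP] := continuous_bounded M fc; exists N => t /KM /NP.
Qed.

(* Away from the diagonal, [(k x - k y)^2] is bounded by a multiple of [(x - y)^2]. *)
Lemma continuous_sqr_dist k (B e : R) : continuous k -> 0 < e ->
  exists C : R, forall s t, rabs s <= B -> rabs t <= B ->
    (k s - k t) ^+ 2 <= e + C * (s - t) ^+ 2.
Proof.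
move=> kc e0; have [N NP] := continuous_bounded B kc.
(* Chosen so that d^2 <= e. *)
pose d := Num.min 1 e.
have d0 : 0 < d by rewrite lt_min ltr01 e0.
have d1 : d <= 1 by rewrite ge_min lexx.
have de : d <= e by rewrite ge_min lexx orbT.
have [||||r r0 rP] := @uniform_on_compact R [set t | rabs t <= B]%classic
  (fun s t => rabs (k s - k t)) B _ _ _ _ d d0.
- by [].
- move=> l ll /=; apply/ler_addgt0Pr => q /ll [t /= tM tl].
  have := ler_normB t (t - l); rewrite opprB addrC subrK.
  by move: tM tl; lra.
- move=> q s t; rewrite (distrC (k q)); have := ler_normD (k s - k q) (k q - k t).
  by rewrite addrA subrK.
- move=> l _ q q0; have [p p0 pP] := (continuous_epsP k).1 kc l q q0.
  by exists p => // t _ /pP; rewrite distrC.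
exists (4 * N ^+ 2 / r ^+ 2) => x y xB yB.
have r2 : 0 < r ^+ 2 by rewrite exprn_gt0.
have N0 : 0 <= 4 * N ^+ 2 by rewrite mulr_ge0 ?ler0n ?sqr_ge0.
have c0 : 0 <= 4 * N ^+ 2 / r ^+ 2 by rewrite divr_ge0 ?sqr_ge0.
have [near|far] := ltP (rabs (x - y)) r.
  have := rP _ _ xB yB near; set D := k x - k y => Dd.
  have D0 : 0 <= rabs D := normr_ge0 D.
  have : D ^+ 2 <= e by rewrite -(real_normK (num_real D)); nra.
  by have := mulr_ge0 c0 (sqr_ge0 (x - y)); lra.
have h1 : r ^+ 2 <= (x - y) ^+ 2.
  by rewrite -(real_normK (num_real (x - y))) ler_sqr ?nnegrE // ltW.
have h2 : (k x - k y) ^+ 2 <= 4 * N ^+ 2.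
  have := NP _ xB; have := NP _ yB; rewrite !ler_norml => /andP[? ?] /andP[? ?].
  by nra.
have : 4 * N ^+ 2 <= 4 * N ^+ 2 / r ^+ 2 * (x - y) ^+ 2.
  by rewrite -mulrA ler_peMr // mulrC ler_pdivlMr // mul1r.
by lra.
Qed.

(* Read for [K = L] and [f = g = id], this is the uniqueness of the calculus; in general,
   [tau ((F (k o f) - G (k o g)) ^ 2)] is bounded by [r + C tau ((F f - G g) ^ 2)]. *)
Lemma rcalc_comp_eq K L F G f g k : real_calculus K F -> real_calculus L G ->
  continuous f -> continuous g -> continuous k -> F f = G g ->
  F (fun t => k (f t)) = G (fun t => k (g t)).
Proof.
move=> FP GP fc gc kc e.
have kf := continuous_comp_fun fc kc; have kg := continuous_comp_fun gc kc.
apply/eqP; rewrite -subr_eq0; apply/eqP.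
apply: (retr_sqr_eq0 tau_state tau_faithful).
  by rewrite starB (rcalc_star FP) // (rcalc_star GP).
apply/ler_addgt0Pr => r r0; rewrite add0r.
have [B1 B1P] := bounded_fun_calculus FP fc; have [B2 B2P] := bounded_fun_calculus GP gc.
have [C CP] := continuous_sqr_dist (Num.max B1 B2) kc r0.
(* The four products expand r + C (f s - g t)^2 - (k (f s) - k (g t))^2, nonnegative by [CP]. Since
   F f = G g, the middle square contributes nothing to the trace. *)
have := @retr_bilinear4_1_ge0 K L F G
  (fun t => r + (C * (f t * f t) + (-1) * (k (f t) * k (f t))))
  (fun t => (- (2 * C)) * f t) (fun t => 2 * k (f t)) (fun=> 1)
  (fun=> 1) g (fun t => k (g t)) (fun t => C * (g t * g t) + (-1) * (k (g t) * k (g t)))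
  FP GP.
have cC f' : continuous f' -> continuous (fun t => k (f' t)) ->
    continuous (fun t => C * (f' t * f' t) + (-1) * (k (f' t) * k (f' t))).
  move=> c1 c2.
  exact (continuousD_fun (continuousZ_fun C (continuousM_fun c1 c1))
    (continuousZ_fun (-1) (continuousM_fun c2 c2))).
have c0 := cC f fc kf; have c3 := cC g gc kg.
have c0' := continuousD_fun (continuous_cst r) c0.
have c1 := continuousZ_fun (- (2 * C)) fc; have c2 := continuousZ_fun 2 kf.
have cc := @continuous_cst R 1.
move=> /(_ (And4 c0' c1 c2 cc) (And4 cc gc kg c3)) H.
lapply H; last first.
  move=> s t Ks Lt; have := CP (f s) (g t).
  rewrite !le_max B1P // B2P // orbT => /(_ erefl erefl).
  by move: (f s) (g t) => v1 v2; move: (k v1) (k v2) => v3 v4; nra.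
have ff := continuousM_fun fc fc; have gg := continuousM_fun gc gc.
have kff := continuousM_fun kf kf; have kgg := continuousM_fun kg kg.
have sq (J : set R) (h : (R -> R) -> A) (h1 h2 : R -> R) :
    real_calculus J h -> continuous h1 -> continuous h2 ->
    h (fun t : R => C * (h1 t * h1 t) + (-1) * (h2 t * h2 t)) =
    C%:C *: (h h1 * h h1) - h h2 * h h2.
  move=> hP c h2c.
  have c11 := continuousM_fun c c; have c22 := continuousM_fun h2c h2c.
  rewrite (rcalcD hP (continuousZ_fun C c11) (continuousZ_fun (-1) c22)).
  rewrite (rcalcZ hP _ c11) (rcalcZ hP _ c22) !(rcalcM hP) //.
  by rewrite real_complexN scaleNr scale1r.
rewrite (rcalcD FP (continuous_cst r) c0) (rcalc_cst FP) (rcalc1 GP) (rcalc1 FP).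
rewrite (rcalcZ FP _ fc) (rcalcZ FP _ kf) (sq _ _ _ _ FP fc kf) (sq _ _ _ _ GP gc kg).
rewrite mul1r mulr1 -!scalerAl e retr_sqrB.
rewrite !(retrD tau) !(retrN tau) !(retrZ tau).
by rewrite (retr1 tau_state) mulr1; lra.
Qed.

End Young.

(** * Young's inequality *)

Section YoungInequality.
Context {R : realType} {A : cstarAlgType R} (tau : {scalar A}).
Hypotheses (tau_state : state tau) (tau_tracial : tracial tau).
Hypothesis tau_faithful : faithful tau.
Local Notation rabs := (@Num.norm R R).
Local Notation retr := (retr tau).
Implicit Types (a b x y u w h : A) (f g k l : R -> R) (K L : set R) (F G : (R -> R) -> A).

Lemma cont_spectrum_eq a (f g : R[i]^o -> R[i]^o) :
  (forall z, spectrum a z -> f z = g z) -> cont_spectrum a g -> cont_spectrum a f.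
Proof.
move=> fg /cont_spectrumP gc; apply/cont_spectrumP => z az e e0.
have [d d0 dP] := gc z az e e0; exists d => // w aw wz.
by rewrite !fg //; exact: dP.
Qed.

(** [cpow] evaluates whichever calculus [xget] returns, possibly a different one for each r;
    [rcalc_comp_eq] identifies its value with that of the one [F], since both send the identity to
    [a]. *)
Lemma positive_calculus a : positive a -> exists K F,
  [/\ real_calculus K F, F id = a, forall t, K t -> 0 <= t &
      forall r, 0 < r -> cpow a r = F (pw r)].
Proof.
move=> [sa pos]; have [F [FP Fid]] := selfadjoint_real_calculus sa.
exists [set t | spectrum a t%:C]%classic, F; split=> //.
  by move=> t /pos; rewrite lecR.
move=> r r0; pose f := fun z : R[i]^o => ((complex.Re z) `^ r)%:C : R[i]^o.
have fE z : spectrum a z -> f z = real_extension (pw r) z.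
  move=> az; rewrite /f /real_extension pwE //.
  by have := pos _ az; rewrite lecE => /andP[].
have [Phi PhiP] := functional_calculus_exists sa.
have [Psi PsiP e] : exists2 Psi, is_functional_calculus a Psi & cpow a r = Psi f.
  have ex : exists x, [set x | exists2 Phi, is_functional_calculus a Phi & x = Phi f]%classic x.
    by exists (Phi f), Phi.
  exact: (xgetPex 0 ex).
have [HP Hid] := functional_real_calculus sa PsiP.
have pc := continuous_pw r0.
have fc : cont_spectrum a f.
  exact (cont_spectrum_eq fE (@cont_real_extension R A a _ pc)).
rewrite e (fcalc_ext PsiP fc (@cont_real_extension R A a _ pc) fE).
have idc := @continuous_idr R.
by apply: (rcalc_comp_eq tau_state tau_tracial tau_faithful HP FP idc idc pc); rewrite Hid Fid.
Qed.

(** By [sqrt_1B], 1 - u* u is the square of a selfadjoint element. *)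
Lemma retr_contraction_le w u : star w = w -> cnorm u <= 1 ->
  retr (w * w * (star u * u)) <= retr (w * w).
Proof.
move=> sw u1.
have [||v [sv vE _]] := @sqrt_1B R A (star u * u).
- by rewrite starM starK.
- by rewrite cnorm_star expr_le1 // cnorm_ge0.
have := retr_sandwich_ge0 tau_state tau_tracial v sw.
by rewrite sv -[v * v]expr2 vE mulrBr mulr1 (retrB tau) subr_ge0.
Qed.

Section Calculi.
Variables (K L : set R) (F G : (R -> R) -> A) (p q : R).
Hypotheses (FP : real_calculus K F) (GP : real_calculus L G).
Hypotheses (K0 : forall t, K t -> 0 <= t) (L0 : forall t, L t -> 0 <= t).
Hypotheses (p0 : 0 < p) (q0 : 0 < q) (pq : p^-1 + q^-1 = 1).

Let half_sqr (r : R) : 0 < r ->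
  continuous (pw (r / 2)) /\ forall t : R, pw (r / 2) t * pw (r / 2) t = pw r t.
Proof.
move=> r0; split; first by apply: continuous_pw; rewrite divr_gt0.
move=> t; rewrite /pw -powRD; first by congr (_ `^ _); field.
by apply/implyP => /eqP; lra.
Qed.

Lemma rcalc_pw_half (J : set R) (H : (R -> R) -> A) (r : R) : real_calculus J H -> 0 < r ->
  H (pw r) = H (pw (r / 2)) * H (pw (r / 2)).
Proof.
move=> HP r0; have [c e] := half_sqr r0; rewrite -(rcalcM HP) //.
by congr H; apply/funext => t; rewrite e.
Qed.

Lemma retr_young :
  Num.min p^-1 q^-1 * retr ((F (pw (p / 2)) - G (pw (q / 2))) *
                            (F (pw (p / 2)) - G (pw (q / 2)))) + retr (F id * G id) <=
  p^-1 * retr (F (pw p)) + q^-1 * retr (G (pw q)).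
Proof.
set m := Num.min _ _.
have [pc pe] := half_sqr p0; have [qc qe] := half_sqr q0.
have p1c := continuous_pw p0; have q1c := continuous_pw q0.
have idc := @continuous_idr R; have cc := @continuous_cst R 1.
(* Coefficients of [young_refined] once (S - T)^2 is expanded, with S^2 = s^p and T^2 = t^q. *)
have c0 := continuousZ_fun (p^-1 - m) p1c; have c1 := continuousZ_fun (2 * m) pc.
have c2 := continuousZ_fun (-1) idc; have c3 := continuousZ_fun (q^-1 - m) q1c.
have H := @retr_bilinear4_1_ge0 R A tau tau_state tau_tracial K L F G _ _ _ _ _ _ _ _
  FP GP (And4 c0 c1 c2 cc) (And4 cc qc idc c3).
lapply H => {H}; last first.
  move=> s t Ks Lt; have := young_refined p0 q0 pq (K0 Ks) (L0 Lt).
  rewrite -/m -(pe s) -(qe t); move: (pw _ s) (pw _ t) => S T; nra.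
rewrite (rcalcZ FP _ p1c) (rcalcZ FP _ pc) (rcalcZ FP _ idc) (rcalcZ GP _ q1c).
rewrite (rcalc1 FP) (rcalc1 GP) mulr1 mul1r -!scalerAl !(retrZ tau).
rewrite retr_sqrB // -(rcalc_pw_half FP p0) -(rcalc_pw_half GP q0); lra.
Qed.

Lemma retr_young_contraction u : cnorm u <= 1 ->
  retr (F id * (star u * G id * u)) <= p^-1 * retr (F (pw p)) + q^-1 * retr (G (pw q)).
Proof.
move=> u1.
have [pc pe] := half_sqr p0; have [qc qe] := half_sqr q0.
have p1c := continuous_pw p0; have q1c := continuous_pw q0.
have idc := @continuous_idr R; have cc := @continuous_cst R 1.
have zc := @continuous_cst R 0.
have c0 := continuousZ_fun p^-1 p1c.
have c2 := continuousZ_fun (-1) idc; have c3 := continuousZ_fun q^-1 q1c.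
have H := @retr_bilinear4_ge0 R A tau tau_state tau_tracial K L F G _ _ _ _ _ _ _ _ u
  FP GP (And4 c0 c2 cc zc) (And4 cc idc c3 zc).
lapply H => {H}; last first.
  move=> s t Ks Lt; have := conjugate_powR (K0 Ks) (L0 Lt) p0 q0 pq.
  rewrite (pwE _ (K0 Ks)) (pwE _ (L0 Lt)) /=; lra.
rewrite (rcalcZ FP _ p1c) (rcalcZ FP _ idc) (rcalcZ GP _ q1c).
rewrite (rcalc1 FP) (rcalc1 GP) (rcalc0 FP) mul0r mulr1 mul1r.
rewrite -!(scalerAl, scalerAr) !(retrZ tau) (retr0 tau) addr0 => H.
have sF := rcalc_star FP pc; have sG := rcalc_star GP qc.
have h1 := retr_contraction_le sF u1; have h2 := @retr_contraction_le _ (star u) sG.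
rewrite cnorm_starE starK in h2; have {}h2 := h2 u1.
rewrite -(rcalc_pw_half FP p0) in h1; rewrite -(rcalc_pw_half GP q0) in h2.
have h3 : retr (star u * G (pw q) * u) = retr (G (pw q) * (u * star u)).
  by rewrite -mulrA (retrC tau_tracial) mulrA.
have p1 : 0 < p^-1 by rewrite invr_gt0.
have q1 : 0 < q^-1 by rewrite invr_gt0.
by rewrite h3 in H; nra.
Qed.

Lemma retr_mul_young u : cnorm u <= 1 ->
  2 * retr (u * (F id * G id)) <=
  2 * (p^-1 * retr (F (pw p)) + q^-1 * retr (G (pw q))) -
  Num.min p^-1 q^-1 * retr ((F (pw (p / 2)) - G (pw (q / 2))) *
                            (F (pw (p / 2)) - G (pw (q / 2)))).
Proof.
move=> u1; have h1 := retr_young; have h2 := retr_young_contraction u1.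
have idc := @continuous_idr R.
have [X sX XE] := rcalc_ge0 FP idc K0; have [Z sZ ZE] := rcalc_ge0 GP idc L0.
(* Here a = X^2 and b = Z^2; by traciality tau (u a b) is the inner product of Z u X and Z X. *)
have := retr_mul_le tau_state tau_tracial (Z * u * X) (Z * X).
rewrite !starM sX sZ.
have -> : retr (Z * u * X * (X * Z)) = retr (u * (F id * G id)).
  by rewrite XE ZE -!mulrA (retrC tau_tracial) !mulrA.
have -> : retr (Z * u * X * (X * (star u * Z))) = retr (F id * (star u * G id * u)).
  rewrite XE ZE (_ : Z * u * X * _ = (Z * u) * (X * X * star u * Z)); last by ncring.
  by rewrite (retrC tau_tracial) !mulrA.
have -> : retr (Z * X * (X * Z)) = retr (F id * G id).
  by rewrite XE ZE -!mulrA (retrC tau_tracial) !mulrA.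
by lra.
Qed.

End Calculi.

Lemma retr_rcalc_mono K F k l : real_calculus K F -> continuous k -> continuous l ->
  (forall t, K t -> k t <= l t) -> retr (F k) <= retr (F l).
Proof.
move=> FP kc lc kl; have kc' := continuousZ_fun (-1) kc.
have [|w sw] := rcalc_ge0 FP (continuousD_fun lc kc').
  by move=> t /kl; rewrite mulN1r subr_ge0.
rewrite (rcalcD FP lc kc') (rcalcZ FP _ kc) real_complexN scaleNr scale1r => e.
by rewrite -subr_ge0 -(retrB tau) e retr_sqr_ge0.
Qed.

(* With [h = |x|], take [u = (h + e)^-1 star x], so that [u x = (h + e)^-1 h^2]. *)
Lemma cabs_approx x (e : R) : 0 < e ->
  exists2 u, cnorm u <= 1 & retr (cabs x) <= retr (u * x) + e.
Proof.
move=> e0; have pos := positive_star_mul tau_state tau_tracial tau_faithful x.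
have [K [F [FP Fid K0 Fpw]]] := positive_calculus pos.
have h0 : 0 < 2^-1 :> R by rewrite invr_gt0.
rewrite /cabs Fpw //; have pc := continuous_pw h0.
pose g t : R := (pw 2^-1 t + e)^-1.
have g0 t : 0 < pw 2^-1 t + e by have := pw_ge0 2^-1 t; lra.
have gc : continuous g.
  move=> t; apply: cvgV; first by rewrite gt_eqF.
  exact: (continuousD_fun pc (continuous_cst e)).
have idc := @continuous_idr R; have gi := continuousM_fun gc idc.
have gig := continuousM_fun gi gc.
have sq t : K t -> t = pw 2^-1 t * pw 2^-1 t.
  by move=> /K0 t0; rewrite pwE // -expr2 -powR_mulrn ?powR_ge0 // -powRrM mulVf ?powRr1.
exists (F g * star x).
  (* |u|^2 = |u u*|, and u u* is the value at [star x * x] of g(t)^2 t = (r / (r + e))^2, where r =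
     sqrt t. *)
  rewrite -(ler_sqr (cnorm_ge0 _) ler01) expr1n -cnorm_starE -cnorm_star starK.
  rewrite starM starK (rcalc_star FP) //.
  rewrite (_ : F g * star x * (x * F g) = F g * F id * F g); last by rewrite Fid !mulrA.
  rewrite -(rcalcM FP gc idc) -(rcalcM FP gi gc).
  apply: (rcalc_contractive FP gig) => t Kt.
  rewrite {2}(sq _ Kt) /g; set r := pw _ t; have r0 : 0 <= r := pw_ge0 _ _.
  have re : 0 < r + e by lra.
  rewrite (_ : _ * _ = (r / (r + e)) ^+ 2); last by field; rewrite gt_eqF.
  have d0 : 0 <= r / (r + e) by rewrite divr_ge0 // ltW.
  by rewrite ger0_norm ?sqr_ge0 // expr_le1 // ler_pdivrMr // mul1r lerDl ltW.
rewrite -mulrA -Fid -(rcalcM FP gc idc).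
have ec := continuous_cst e.
have -> : retr (F (fun t => g t * id t)) + e = retr (F (fun t => g t * id t + e)).
  by rewrite (rcalcD FP gi ec) (rcalc_cst FP) (retrD tau) (retrZ tau) (retr1 tau_state) mulr1.
apply: (retr_rcalc_mono FP pc (continuousD_fun gi ec)) => t Kt /=.
rewrite {3}(sq _ Kt) /g; set r := pw _ t; have r0 : 0 <= r := pw_ge0 _ _.
have re : 0 < r + e by lra.
rewrite -subr_ge0 (_ : _ - _ = e ^+ 2 / (r + e)).
  by rewrite divr_ge0 ?sqr_ge0 ?ltW.
by field; rewrite gt_eqF.
Qed.

End YoungInequality.

Theorem theorem1p2 (R : realType) (A : cstarAlgType R) (tau : {scalar A})
    (tau_state : state tau) (tau_tracial : tracial tau)
    (tau_faithful : faithful tau)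
    (p q : R) (p_gt0 : 0 < p) (q_gt0 : 0 < q) (pq : p^-1 + q^-1 = 1)
    (a b : A) (a_pos : positive a) (b_pos : positive b) :
  tau (cabs (a * b)) <=
    (p^-1)%:C * tau (cpow a p) + (q^-1)%:C * tau (cpow b q) /\
  (tau (cabs (a * b)) =
     (p^-1)%:C * tau (cpow a p) + (q^-1)%:C * tau (cpow b q) <->
   cpow b q = cpow a p).
Proof.
have [K [F [FP Fid K0 Fpw]]] := positive_calculus tau_state tau_tracial tau_faithful a_pos.
have [L [G [GP Gid L0 Gpw]]] := positive_calculus tau_state tau_tracial tau_faithful b_pos.
have pos := positive_star_mul tau_state tau_tracial tau_faithful (a * b).
have [J [H [HP Hid J0 Hpw]]] := positive_calculus tau_state tau_tracial tau_faithful pos.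
have h0 : 0 < 2^-1 :> R by rewrite invr_gt0.
have hc := continuous_pw h0.
have pc := continuous_pw p_gt0; have qc := continuous_pw q_gt0.
have p2 : 0 < p / 2 by rewrite divr_gt0.
have q2 : 0 < q / 2 by rewrite divr_gt0.
have cabsE : cabs (a * b) = H (pw 2^-1) by exact: Hpw.
rewrite Fpw // Gpw // cabsE.
rewrite (tau_real tau_state (rcalc_star HP hc)) (tau_real tau_state (rcalc_star FP pc)).
rewrite (tau_real tau_state (rcalc_star GP qc)) -!real_complexM -real_complexD.
pose m := Num.min p^-1 q^-1; pose D := F (pw (p / 2)) - G (pw (q / 2)).
have sD : star D = D.
  by rewrite /D starB (rcalc_star FP (continuous_pw p2)) (rcalc_star GP (continuous_pw q2)).
have m0 : 0 < m by rewrite lt_min !invr_gt0 p_gt0.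
have D0 : 0 <= retr tau (D * D) by exact: retr_sqr_ge0.
(* The approximants [u] vary with e while [D] does not, so the remainder is still there as e tends
   to 0. *)
have key : 2 * retr tau (H (pw 2^-1)) <=
    2 * (p^-1 * retr tau (F (pw p)) + q^-1 * retr tau (G (pw q))) - m * retr tau (D * D).
  apply/ler_addgt0Pr => e e0; have e2 : 0 < e / 2 by rewrite divr_gt0.
  have [u u1] := cabs_approx tau_state tau_tracial tau_faithful (a * b) e2.
  rewrite cabsE -Fid -Gid => ux.
  have := retr_mul_young tau_state tau_tracial FP GP K0 L0 p_gt0 q_gt0 pq u1.
  by rewrite -/m -/D; lra.
have mD : 0 <= m * retr tau (D * D) by rewrite mulr_ge0 // ltW.
split; first by rewrite lecR; lra.
split=> [/complexI e | e].
  have D1 : D = 0.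
    apply: (retr_sqr_eq0 tau_state tau_faithful sD).
    by rewrite -(ler_pM2l m0) mulr0; lra.
  have /eqP := D1; rewrite subr_eq0 => /eqP D2.
  by rewrite (rcalc_pw_half FP p_gt0) (rcalc_pw_half GP q_gt0) D2.
have q1 : 0 < q^-1 by rewrite invr_gt0.
have idc := @continuous_idr R; have qic := continuous_pw q1.
have pq0 : 0 < p / q by rewrite divr_gt0.
(* The power 1/q is applied to G (pw q) = F (pw p), an equality between two different calculi. *)
have bE : b = F (pw (p / q)).
  have := rcalc_comp_eq tau_state tau_tracial tau_faithful GP FP qc pc qic e.
  rewrite (_ : G _ = G id); last first.
    apply: (rcalc_ext GP (continuous_comp_fun qc qic) idc).
    by move=> t /L0 t0; rewrite !pwE ?powR_ge0 // -powRrM mulfV ?gt_eqF // powRr1.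
  rewrite Gid => ->; congr F; apply/funext => t.
  by rewrite [LHS]pwE ?pw_ge0 // /pw -powRrM.
have abE : a * b = F (pw p).
  have pqc := continuous_pw pq0; rewrite bE -{1}Fid -(rcalcM FP idc pqc).
  apply: (rcalc_ext FP (continuousM_fun idc pqc) pc).
  (* p / q = p - 1 by conjugacy, so a b = a a^(p-1) = a^p. *)
  move=> t /K0 t0; rewrite !pwE // (_ : p / q = p - 1) ?mulr_powRB1 //.
  have -> : q^-1 = 1 - p^-1 by lra.
  by rewrite mulrBr mulr1 mulfV ?gt_eqF.
have ppc := continuousM_fun pc pc.
(* The identity in [H] and (a^p)^2 in [F] are the same element; taking square roots of both gives
   |ab| = a^p. *)
have HF : H (pw 2^-1) = F (pw p).
  have HFE : H id = F (fun t => pw p t * pw p t).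
    by rewrite Hid abE (rcalc_star FP pc) -(rcalcM FP pc pc).
  have := rcalc_comp_eq tau_state tau_tracial tau_faithful HP FP idc ppc hc HFE.
  move=> ->; congr F; apply/funext => t.
  have r0 := pw_ge0 p t; rewrite pwE ?mulr_ge0 // -expr2 -powR_mulrn //.
  by rewrite -powRrM mulfV ?powRr1 // pnatr_eq0.
by rewrite HF e -mulrDl pq mul1r.
Qed.
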